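(* For every integer $n\ge 1$, $\omega_n$ is the least ordinal $\varepsilon$ such that the inverse system $\mathbf d_n\mathbf P_n(\varepsilon)$ is not free.
   Context: For a set $A$ of ordinals and $n\ge 0$, $P_n(A)$ is the free abelian group with generators $\langle\vec\alpha\rangle$, $\vec\alpha\in[A]^{n+1}$ (strictly increasing $(n+1)$-tuples from $A$). For $n\ge1$, $d_n:P_n(A)\to P_{n-1}(A)$ is the homomorphism $\langle\vec\alpha\rangle\mapsto\sum_{i=0}^n(-1)^i\langle\vec\alpha^i\rangle$, where $\vec\alpha^i$ omits the $i$-th coordinate (counting from $0$). An inverse system of abelian groups indexed by an ordinal $\varepsilon$ is $\mathbf X=(X_\alpha,x_{\alpha\beta},\varepsilon)$ with groups $X_\alpha$ ($\alpha<\varepsilon$) and homomorphisms $x_{\alpha\beta}:X_\beta\to X_\alpha$ ($\alpha\le\beta<\varepsilon$) with $x_{\alpha\alpha}=\mathrm{id}$ and $x_{\alpha\gamma}=x_{\alpha\beta}x_{\beta\gamma}$. $\mathbf P_n(\varepsilon)$ is the system with terms $P_n([\alpha,\varepsilon))$ and the natural inclusions as bonding maps; for $n\ge1$, $\mathbf d_n\mathbf P_n(\varepsilon)$ is the system whose term at $\alpha$ is the subgroup $d_n(P_n([\alpha,\varepsilon)))$ of $P_{n-1}([\alpha,\varepsilon))$, with inclusions as bonding maps. A system $\mathbf X$ is free if there is a set $\mathcal B\subseteq\bigcup_{\alpha<\varepsilon}X_\alpha$ such that every $x$ in every $X_\alpha$ has a unique decomposition $x=\sum_{i<k}a_i\,x_{\alpha\beta_i}(b_i)$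 with $\alpha\le\beta_i$, $b_i\in X_{\beta_i}\cap\mathcal B$ distinct and $a_i$ nonzero integers. *)

(* Defs.v *)
From HB Require Import structures.
From mathcomp.multinomials Require Import freeg.
From mathcomp Require Import all_boot all_order all_algebra.
From mathcomp Require Import boolp classical_sets functions cardinality wochoice.

Set Implicit Arguments.
Unset Strict Implicit.
Unset Printing Implicit Defensive.

Import Order.TTheory GRing.Theory.
Local Open Scope ring_scope.

(* Ordinals are represented by well-ordered types, compared through their     *)
(* order types: ord_le e1 e2 says that e1 is isomorphic to an initial segment *)
(* of e2 (possibly all of it).                                                *)
Record ord := Ord {
  ord_disp : Order.disp_t;
  ord_sort :> orderType ord_disp;
  ordP : well_order (<=%O : rel ord_sort)
}.

Definition ord_le (e1 e2 : ord) : Prop :=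
  exists2 f : e1 -> e2,
    {mono f : x y / (x <= y)%O} &
    forall (x : e1) (y : e2), (y <= f x)%O -> exists z, f z = y.

Definition is_least_ord (P : ord -> Prop) (e : ord) : Prop :=
  P e /\ forall e', P e' -> ord_le e e'.

(* The order type of e is omega_n: omega_0 is the least infinite ordinal, and *)
(* omega_{n+1} the least ordinal of cardinality greater than that of omega_n. *)
Fixpoint is_omega (n : nat) (e : ord) : Prop :=
  if n is m.+1 then
    exists2 e0, is_omega m e0 &
      is_least_ord (fun e' : ord => ~ ([set: e'] #<= [set: e0])%card) e
  else is_least_ord (fun e' : ord => infinite_set [set: e']) e.

(* Ordinals are comparable, every nonempty class of ordinals has a least      *)
(* element, and hence omega_n exists.                                         *)
Section Existence.

Lemma ord_min (e : ord) (Q : e -> Prop) : (exists x, Q x) ->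
  exists x, Q x /\ forall y, Q y -> (x <= y)%O.
Proof.
move=> [x Qx]; have [|z [[/asboolP Qz lbz] _]] := @ordP e (fun x => `[< Q x >]).
  by exists x; apply/asboolP.
by exists z; split=> // y Qy; apply: lbz; apply/asboolP.
Qed.

Lemma ord_ind (e : ord) (Q : e -> Prop) :
  (forall x, (forall y, (y < x)%O -> Q y) -> Q x) -> forall x, Q x.
Proof.
move=> IH x; apply: contrapT => nQx.
have [z [nQz lbz]] := @ord_min e (fun x => ~ Q x) (ex_intro _ x nQx).
apply: nQz; apply: IH => y lt_yz; apply: contrapT => /lbz.
by rewrite leNgt lt_yz.
Qed.

Section Compare.
Variables V W : ord.

Let emb (f : V -> W) x :=
  (forall z z', (z <= x)%O -> (z' <= x)%O -> (f z <= f z')%O = (z <= z')%O) /\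
  (forall z w, (z <= x)%O -> (w <= f z)%O -> exists2 z', (z' <= x)%O & f z' = w).

Let emb_lt f x z z' : emb f x -> (z <= x)%O -> (z' <= x)%O ->
  (f z < f z')%O = (z < z')%O.
Proof. by move=> [fm _] hz hz'; rewrite !ltNge fm. Qed.

Let emb_uniq f g x x' : emb f x -> emb g x' ->
  forall z, (z <= x)%O -> (z <= x')%O -> f z = g z.
Proof.
move=> ef eg; apply: ord_ind => z IH zx zx'.
case: (ltgtP (f z) (g z)) => // lt.
- have [z' z'x' gz'] := eg.2 z (f z) zx' (ltW lt).
  have z'z : (z' < z)%O by rewrite -(emb_lt eg) // gz'.
  have /IH h := z'z; rewrite -h // in gz'; last exact: le_trans (ltW z'z) zx.
  by have := emb_lt ef (le_trans (ltW z'z) zx) zx; rewrite z'z gz' ltxx.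
- have [z' z'x fz'] := ef.2 z (g z) zx (ltW lt).
  have z'z : (z' < z)%O by rewrite -(emb_lt ef) // fz'.
  have /IH h := z'z; rewrite h // in fz'; last exact: le_trans (ltW z'z) zx'.
  by have := emb_lt eg (le_trans (ltW z'z) zx') zx'; rewrite z'z fz' ltxx.
Qed.

Let G x y := exists2 f, emb f x & f x = y.

Let G_fun x y y' : G x y -> G x y' -> y = y'.
Proof. by move=> [f ef <-] [g eg <-]; apply: (emb_uniq ef eg). Qed.

Let G_lt x y x' y' : G x y -> G x' y' -> (x < x')%O -> (y < y')%O.
Proof.
move=> [f ef <-] [g eg <-] xx'; rewrite (emb_uniq ef eg) ?(ltW xx') //.
by rewrite (emb_lt eg) ?(ltW xx').
Qed.

Let G_down x y w : G x y -> (w <= y)%O -> exists2 z, (z <= x)%O & G z w.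
Proof.
move=> [f ef <-] wy; have [z zx fz] := ef.2 x w (lexx x) wy; exists z => //.
exists f => //; split=> [u u' uz u'z|u v uz vu].
  by apply: ef.1; [exact: le_trans uz zx|exact: le_trans u'z zx].
have [t tx ft] := ef.2 u v (le_trans uz zx) vu; exists t => //.
by rewrite (le_trans _ uz) // -ef.1 ?ft // (le_trans uz zx).
Qed.

Lemma ord_comparable : ord_le V W \/
  exists (x : V) (g : W -> V), {mono g : u v / (u <= v)%O} /\
    forall z, (z < x)%O <-> exists w, g w = z.
Proof.
have [allG|/existsNP[x1 nG1]] := pselect (forall x, exists y, G x y).
  left; have [f fG] := choice allG; exists f.
    by apply: le_mono => x y; apply: G_lt.
  by move=> x y yx; have [z zx Gz] := G_down (fG x) yx; exists z; exact: G_fun Gz.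
right; have [x [nG minx]] := @ord_min V (fun x => ~ exists y, G x y)
  (ex_intro _ x1 nG1).
have Gx z : (z < x)%O -> exists y, G z y.
  by move=> zx; apply: contrapT => /minx; rewrite leNgt zx.
have surj w : exists2 z, (z < x)%O & G z w.
  apply: contrapT => nw.
  have [w0 [nw0 minw]] := @ord_min W (fun w => ~ exists2 z, (z < x)%O & G z w)
    (ex_intro _ w nw).
  have lt0 z y : (z < x)%O -> G z y -> (y < w0)%O.
    move=> zx Gzy; rewrite ltNge; apply/negP => w0y.
    have [u uz Gu] := G_down Gzy w0y.
    by apply: nw0; exists u => //; exact: le_lt_trans uz zx.
  have ex z : exists y, if (z < x)%O then G z y else y = w0.
    by have [zx|_] := boolP (z < x)%O; [exact: Gx|exists w0].
  have [f fP] := choice ex; apply: nG; exists w0.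
  have fx : f x = w0 by have := fP x; rewrite ltxx.
  have fG z : (z < x)%O -> G z (f z) by have := fP z; case: ifP.
  have flt z z' : (z <= x)%O -> (z' <= x)%O -> (z < z')%O -> (f z < f z')%O.
    move=> zx; rewrite le_eqVlt => /orP[/eqP->|z'x] zz'.
      by rewrite fx; apply: lt0 (fG _ zz').
    exact: (G_lt (fG _ (lt_trans zz' z'x)) (fG _ z'x) zz').
  exists f => //; split=> [z z' zx z'x|z u].
    case: (ltgtP z z') => [/(flt _ _ zx z'x)/ltW//|/(flt _ _ z'x zx)|->//].
      by rewrite leNgt => ->.
    by rewrite lexx.
  rewrite le_eqVlt => /orP[/eqP->|zx]; last first.
    move=> /(G_down (fG _ zx))[v vz Gv]; exists v.
      exact: le_trans vz (ltW zx).
    by apply: (G_fun _ Gv); apply: fG; exact: le_lt_trans zx.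
  rewrite fx le_eqVlt => /orP[/eqP->|uw0]; first by exists x.
  have [v vx Gv] : exists2 z, (z < x)%O & G z u.
    by apply: contrapT => /minw; rewrite leNgt uw0.
  by exists v; [exact: ltW|exact: G_fun (fG _ vx) Gv].
have /choice[g gP] : forall w, exists z, (z < x)%O /\ G z w.
  by move=> w; have [z zx Gz] := surj w; exists z.
exists x, g; split.
  apply: le_mono => u v uv; rewrite ltNge; apply/negP.
  rewrite le_eqVlt => /orP[/eqP vu|].
    have := (gP v).2; rewrite vu => /(G_fun (gP u).2) E.
    by rewrite E ltxx in uv.
  by move=> /(G_lt (gP v).2 (gP u).2); rewrite ltNge (ltW uv).
move=> z; split=> [zx|[w <-]]; last exact: (gP w).1.
have [y Gy] := Gx _ zx; exists y.
by have [/(G_lt (gP y).2 Gy)|/(G_lt Gy (gP y).2)|//] := ltgtP (g y) z;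
  rewrite ltxx.
Qed.

End Compare.

Lemma ord_le_trans e1 e2 e3 : ord_le e1 e2 -> ord_le e2 e3 -> ord_le e1 e3.
Proof.
move=> [f fm fi] [g gm gi]; exists (g \o f) => [x y|x y] /=.
  by rewrite gm fm.
move=> h; have [z gz] := gi _ _ h; rewrite -gz gm in h.
by have [t ft] := fi _ _ h; exists t; rewrite ft.
Qed.

Lemma least_ord_exists (P : ord -> Prop) :
  (exists e, P e) -> exists e, is_least_ord P e.
Proof.
move=> [V PV].
pose Q (x : V) := exists2 W, P W & exists g : W -> V,
  {mono g : u v / (u <= v)%O} /\ forall z, (z < x)%O <-> exists w, g w = z.
have [exQ|nQ] := pselect (exists x, Q x); last first.
  exists V; split=> // W PW; have [//|[x hx]] := ord_comparable V W.
  by exfalso; apply: nQ; exists x, W.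
have [x [[W PW [g [gm gi]]] minx]] := ord_min exQ.
exists W; split=> // W' PW'.
have [VW'|[x' [g' [g'm g'i]]]] := ord_comparable V W'.
  apply: ord_le_trans VW'; exists g => // w y yw; apply/gi.
  by apply: le_lt_trans yw _; apply/gi; exists w.
have xx' : (x <= x')%O by apply: minx; exists W' => //; exists g'.
have /choice[h hP] w : exists w', g' w' = g w.
  by apply/g'i; apply: lt_le_trans xx'; apply/gi; exists w.
exists h => [u v|u w hw]; first by rewrite -g'm !hP gm.
have : (g' w <= g u)%O by rewrite -hP g'm.
have gu : (g u < x)%O by apply/gi; exists u.
move=> /le_lt_trans /(_ gu) /gi [v gv]; exists v.
by apply: (inc_inj g'm); rewrite hP.
Qed.

Section OfRel.
Variables (T : choiceType) (R : rel T) (Rwo : well_order R).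

Definition wo_copy (_ : well_order R) : Type := T.
HB.instance Definition _ := Choice.on (wo_copy Rwo).

Let RC : wo_chain R predT. Proof. exact: withinW. Qed.
Let R_refl : reflexive R.
Proof. by move=> x; exact: (wo_chain_reflexive RC). Qed.
Let R_anti : antisymmetric R.
Proof. by move=> x y; exact: (wo_chain_antisymmetric RC). Qed.
Let R_total : total R.
Proof. by move=> x y; exact: (wo_chainW RC). Qed.
Let R_trans : transitive R.
Proof.
move=> y x z Rxy Ryz; have [|m [[mA lbm] _]] := Rwo (A := pred3 x y z).
  by exists x; rewrite !inE eqxx.
have [lx ly lz] : [/\ R m x, R m y & R m z].
  by split; apply: lbm; rewrite !inE eqxx ?orbT.
move: mA; rewrite !inE => /or3P[]/eqP E; rewrite E in lx ly lz => //.
  by have -> : x = y by apply: R_anti; rewrite Rxy lx.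
have <- : y = z by apply: R_anti; rewrite Ryz ly.
by [].
Qed.

HB.instance Definition _ :=
  Order.Le_isPOrder.Build (Order.Disp tt tt) (wo_copy Rwo) R_refl R_anti R_trans.
HB.instance Definition _ :=
  Order.POrder_isTotal.Build (Order.Disp tt tt) (wo_copy Rwo) R_total.

Definition ord_of_rel : ord := @Ord _ (wo_copy Rwo) Rwo.

End OfRel.

Lemma card_le_setTP (T U : Type) :
  ([set: T] #<= [set: U])%card <-> exists f : T -> U, injective f.
Proof.
split=> [/card_leP/unsquash f|[f f_inj]]; last first.
  by have := @card_ge_preimage T U setT f (in2W f_inj); rewrite preimage_setT.
pose i (x : T) : [set: T]%classic := SigSub (mem_set (I : [set: T]%classic x)).
exists (fun x => val (f (i x))) => x y /val_inj /inj.
by rewrite !inE => /(_ I I)/(congr1 val).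
Qed.

Lemma larger_ord_exists (T : Type) :
  exists e : ord, ~ ([set: e] #<= [set: T])%card.
Proof.
have [R Rwo] := well_ordering_principle (T -> Prop).
exists (ord_of_rel Rwo) => /card_le_setTP[g g_inj].
pose D y := exists2 A, g A = y & ~ A y.
have nD : ~ D (g D) by move=> Dg; have [A /g_inj -> ] := Dg.
by apply: (nD); exists D.
Qed.

Lemma is_omega_exists n : exists e, is_omega n e.
Proof.
elim: n => [|n [e0 e0P]]; last first.
  have [e eP] := least_ord_exists (larger_ord_exists e0).
  by exists e, e0.
apply: least_ord_exists.
have nat_wo : well_order (<=%O : rel nat).
  apply: antisymmetric_well_order => [|A Ane]; first exact: le_anti.
  by case: (ex_minnP (P := A) Ane) => m Am minm; exists m; split=> // k; apply: minm.
by exists (Ord nat_wo); exact: infinite_nat.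
Qed.

End Existence.

Record invsys (e : ord) := InvSys {
  term :> e -> zmodType;
  bond : forall a b : e, (a <= b)%O -> {additive term b -> term a};
  bond_id : forall (a : e) (le_aa : (a <= a)%O) (x : term a), bond le_aa x = x;
  bond_comp : forall (a b c : e) (le_ab : (a <= b)%O) (le_bc : (b <= c)%O)
      (le_ac : (a <= c)%O) (x : term c),
    bond le_ac x = bond le_ab (bond le_bc x)
}.

(* A decomposition of x : X a over B is a list of pairs (a_i, (beta_i, b_i))  *)
(* with beta_i in [a, e) and b_i in B at level beta_i; reduced says that the  *)
(* a_i are nonzero and the (beta_i, b_i) pairwise distinct.                   *)
Definition decomposition (e : ord) (X : invsys e) (B : forall b : e, set (X b))
    (a : e) (x : X a)
    (s : seq (int * {b : {b : e | (a <= b)%O} & X (val b)})) : Prop :=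
  [/\ reduced s,
      forall p, p \in s -> B (val (tag p.2)) (tagged p.2)
    & x = \sum_(p <- s) bond X (valP (tag p.2)) (tagged p.2) *~ p.1].

(* B is a subset of the disjoint union of the terms; uniqueness is up to the  *)
(* order of the summands.                                                     *)
Definition free_invsys (e : ord) (X : invsys e) : Prop :=
  exists B : forall b : e, set (X b), forall (a : e) (x : X a),
    exists2 s, decomposition B x s &
      forall s', decomposition B x s' -> perm_eq s s'.

Section Chains.
Variable e : ord.

Record incr (k : nat) := Incr {
  incr_tuple :> k.-tuple e;
  _ : sorted <%O incr_tuple
}.
HB.instance Definition _ k := [isSub for @incr_tuple k].
HB.instance Definition _ k := [Choice of incr k by <:].

Fact omit_subproof k (t : incr k.+1) (i : 'I_k.+1) :
  sorted <%O [tuple tnth t (lift i j) | j < k].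
Proof.
rewrite sorted_map; apply: (@sub_sorted _ (relpre val ltn)); last first.
  by rewrite -sorted_map val_enum_ord iota_ltn_sorted.
have [x0 _] : exists x0 : e, true by exists (tnth t i).
move=> j1 j2 /= lt_j; rewrite !(tnth_nth x0).
case: t => t /= st; rewrite lt_sorted_ltn_nth ?inE ?size_tuple //=;
  try exact: (ltn_ord (lift i _)).
rewrite /bump; case: (leqP i j1) => ij1.
  by rewrite (leq_trans ij1 (ltnW lt_j)) ltn_add2l.
by rewrite add0n (leq_trans lt_j) // leq_addl.
Qed.

Definition omit k (t : incr k.+1) (i : 'I_k.+1) : incr k :=
  Incr (omit_subproof t i).

(* chains k is free abelian on the increasing k-tuples of e, so that P_n(e)   *)
(* is chains n.+1 and, for n >= 1, bdry n is d_n : P_n(e) -> P_{n-1}(e).      *)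
Definition chains (k : nat) := {freeg (incr k)}.

Definition bdry (n : nat) : chains n.+1 -> chains n :=
  fglift (fun t : incr n.+1 => \sum_(i < n.+1) (-1) ^+ i *: << omit t i >>).

(* For a subset A of e, P_n(A) is the subgroup chains_in A of P_n(e): the     *)
(* elements all of whose generators have their entries in A.                  *)
Definition chains_in (k : nat) (A : {pred e}) : {pred chains k} :=
  [pred x | all (fun t : incr k => all (mem A) (incr_tuple t)) (dom x)].

(* The subgroup d_n(P_n([a, e))) of P_{n-1}(e).                               *)
Definition dP_pred (n : nat) (a : e) : {pred chains n} :=
  fun y => `[< exists2 x : chains n.+1,
      x \in chains_in [pred b : e | (a <= b)%O] & y = bdry x >].

Fact bdry_is_additive n : zmod_morphism (@bdry n).
Proof. exact: lift_is_additive. Qed.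
HB.instance Definition _ n :=
  GRing.isZmodMorphism.Build (chains n.+1) (chains n) (@bdry n)
    (@bdry_is_additive n).

Fact chains_in_zmod_closed k A : zmod_closed (@chains_in k A).
Proof.
split; first by rewrite inE dom0.
move=> x y /allP hx /allP hy; apply/allP => t /domB.
by rewrite mem_cat => /orP[/hx|/hy].
Qed.
HB.instance Definition _ k A :=
  GRing.isZmodClosed.Build (chains k) (@chains_in k A)
    (chains_in_zmod_closed k A).

Fact dP_zmod_closed n a : zmod_closed (@dP_pred n a).
Proof.
split; first by apply/asboolP; exists 0; rewrite ?rpred0 ?raddf0.
move=> _ _ /asboolP[x hx ->] /asboolP[y hy ->]; apply/asboolP.
by exists (x - y); rewrite ?rpredB ?raddfB.
Qed.
HB.instance Definition _ n a :=
  GRing.isZmodClosed.Build (chains n) (@dP_pred n a) (dP_zmod_closed n a).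

Record dP_term (n : nat) (a : e) := DPTerm {
  dP_val :> chains n;
  _ : dP_val \in dP_pred a
}.
HB.instance Definition _ n a := [isSub for @dP_val n a].
HB.instance Definition _ n a := [Choice of dP_term n a by <:].
HB.instance Definition _ n a :=
  [SubChoice_isSubZmodule of dP_term n a by <:].

Fact dP_bond_subproof n (a b : e) (le_ab : (a <= b)%O) (y : dP_term n b) :
  dP_val y \in dP_pred a.
Proof.
case: y => y /= /asboolP[x /allP hx ->]; apply/asboolP; exists x => //.
apply/allP => t /hx /allP h; apply/allP => z /h.
by rewrite !inE; exact: le_trans.
Qed.

Definition dP_bond n (a b : e) (le_ab : (a <= b)%O) (y : dP_term n b) :
  dP_term n a := DPTerm (dP_bond_subproof le_ab y).

Fact dP_bond_is_additive n (a b : e) (le_ab : (a <= b)%O) :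
  zmod_morphism (@dP_bond n a b le_ab).
Proof. by move=> x y; exact: val_inj. Qed.
HB.instance Definition _ n a b le_ab :=
  GRing.isZmodMorphism.Build (dP_term n b) (dP_term n a) (@dP_bond n a b le_ab)
    (@dP_bond_is_additive n a b le_ab).

Fact dP_bond_id n (a : e) (le_aa : (a <= a)%O) (y : dP_term n a) :
  dP_bond le_aa y = y.
Proof. exact: val_inj. Qed.

Fact dP_bond_comp n (a b c : e) (le_ab : (a <= b)%O) (le_bc : (b <= c)%O)
  (le_ac : (a <= c)%O) (y : dP_term n c) :
  dP_bond le_ac y = dP_bond le_ab (dP_bond le_bc y).
Proof. exact: val_inj. Qed.

Definition dP (n : nat) : invsys e :=
  @InvSys e (dP_term n) (fun a b le_ab => @dP_bond n a b le_ab)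
    (@dP_bond_id n) (@dP_bond_comp n).

End Chains.

(* Main.v *)
(* Let A be a subset of an ordinal with |A| < aleph_n. By induction on n there *)
(* is a set S of n-simplices of A whose boundaries form a basis of the         *)
(* boundaries of n-simplices of A, simultaneously in every final segment of A: *)
(* reorder A in type at most omega_(n-1), take such a set S_b of               *)
(* (n-1)-simplices for the predecessors of each b in the new order, and let S  *)
(* consist of the s + {b} with s in S_b. Hence d_n P_n(e) is free for          *)
(* e < omega_n.                                                                *)
(*   A basis of d_n P_n(e) yields a section of d_n respecting final segments.  *)
(* Such a section cannot exist over a set D in which every subset of size      *)
(* < aleph_n is bounded. Indeed, choose D' in D closed under the section,      *)
(* bounded by some g in D, and such that every subset of D' of size            *)
(* < aleph_(n-1) is bounded in D'. Coning with g, applying the section, and    *)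
(* taking the coefficient of the complement of D', collapsed to a point,       *)
(* gives a section in dimension n-1 over D'. In dimension 0, a section would   *)
(* have a value whose support lies above every element of D.                   *)
From HB Require Import structures.
From mathcomp.multinomials Require Import freeg.
From mathcomp Require Import all_boot all_order all_algebra.
From mathcomp Require Import boolp classical_sets functions cardinality wochoice.
Require Import Defs.

Set Implicit Arguments.
Unset Strict Implicit.
Unset Printing Implicit Defensive.

Import Order.TTheory GRing.Theory.
Local Open Scope classical_set_scope.
Local Open Scope ring_scope.

(** * Free abelian groups on lists: contraction and coning *)

(** The two halves run parallel inductions, each trading one dimension for one cardinal; coning
    drives both. The list complex is augmented by the empty list, and a cycle of nonempty lists is
    filled by coning from any vertex in its support ([cycle_bounds]).

    Freeness below $\omega_n$. An [acycle] is a higher-dimensional analogue of a spanning tree,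
    chosen so that it also spans in every final segment. For a finite set the greatest point
    suffices ([acycle_finite]). [acycleS] assembles the acycles of the initial segments of a
    reordering into one of the next dimension. A set of size less than $\aleph_{n+1}$ can be
    reordered by an injection into $\omega_n$, whose proper initial segments have size less than
    $\aleph_n$; this gives [small_acycle], and [acycle_free] turns the acycle into a basis of the
    inverse system.

    Non-freeness at $\omega_n$. Choosing a preimage under the boundary map of each basis element
    yields a section respecting final segments ([free_lifting]). [lifting_pred] lowers the dimension
    of such a section at the price of passing to a bounded closed subset, which [big_closed_subset]
    supplies at the price of one cardinal. [no_lifting] iterates this down to points, where
    [no_lifting1] gives a contradiction; regularity of $\omega_n$ ([omega_big]) starts the descent.
    Leastness follows because an ordinal into which $\omega_n$ does not embed as an initial segment
    is itself a proper initial segment of $\omega_n$. *)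

Fact fglift_is_linear (K : choiceType) (M : lmodType int) (f : K -> M) :
  linear (fglift f).
Proof.
pose F := GRing.isZmodMorphism.Build _ _ (fglift f) (lift_is_additive f).
pose g : {additive {freeg K} -> M} := HB.pack (fglift f) F.
move=> a x y; rewrite -[fglift f]/(g : _ -> _) raddfD; congr (_ + _).
by rewrite -[a in LHS]intz -[a in RHS]intz !scaler_int raddfMz.
Qed.
HB.instance Definition _ (K : choiceType) (M : lmodType int) (f : K -> M) :=
  GRing.isLinear.Build int {freeg K} M _ (fglift f) (fglift_is_linear f).

Lemma fglift1 (K : choiceType) (M : lmodType int) (f : K -> M) t :
  fglift f << t >> = f t.
Proof. by rewrite liftU scale1r. Qed.

Section Supports.
Variables (K : choiceType) (M : lmodType int).
Implicit Types (x y : {freeg K}) (P Q : K -> Prop).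

Lemma freegU_scale k (t : K) : << k *g t >> = k *: << t >> :> {freeg K}.
Proof. by apply/eqP/freeg_eqP => u; rewrite coeffZ !coeffU mul1r. Qed.

Lemma freegU_neq0 (t : K) : << t >> <> 0 :> {freeg K}.
Proof. by move/eqP; rewrite freegU_eq0 oner_eq0. Qed.

Definition on P x := forall t, t \in dom x -> P t.

Lemma on0 P : on P 0. Proof. by move=> t; rewrite dom0. Qed.

Lemma onU P t : on P << t >> <-> P t.
Proof.
split=> [|Pt u]; first by apply; rewrite domU1 inE.
by rewrite domU1 inE => /eqP->.
Qed.

Lemma onP P k x y : on P x -> on P y -> on P (k *: x + y).
Proof.
move=> Px Py t /domD_subset; rewrite mem_cat => /orP[|/Py//].
by move=> /domZ_subset/Px.
Qed.

Lemma onD P x y : on P x -> on P y -> on P (x + y).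
Proof. by move=> Px; rewrite -[x]scale1r; apply: onP. Qed.

Lemma onZ P k x : on P x -> on P (k *: x).
Proof. by move=> Px; rewrite -[_ *: _]addr0; apply: onP => //; apply: on0. Qed.

Lemma onN P x : on P x -> on P (- x).
Proof. by rewrite -scaleN1r; apply: onZ. Qed.

Lemma onB P x y : on P x -> on P y -> on P (x - y).
Proof. by move=> Px Py; apply: onD => //; apply: onN. Qed.

Lemma on_sub P Q x : (forall t, P t -> Q t) -> on P x -> on Q x.
Proof. by move=> PQ Px t /Px/PQ. Qed.

Lemma on_and P Q x : on P x -> on Q x -> on (fun t => P t /\ Q t) x.
Proof. by move=> Px Qx t tx; split; [apply: Px|apply: Qx]. Qed.

Lemma on_span P (Q : {freeg K} -> Prop) : Q 0 ->
  (forall k x y, Q x -> Q y -> Q (k *: x + y)) ->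
  (forall t, P t -> Q << t >>) -> forall x, on P x -> Q x.
Proof.
move=> Q0 QP QU x; rewrite -[x in Q x]freeg_sumE /on.
elim: (dom x) => [|t s IH] Px; first by rewrite big_nil.
rewrite big_cons freegU_scale; apply: QP.
  by apply: QU; apply: Px; rewrite mem_head.
by apply: IH => u us; apply: Px; rewrite inE us orbT.
Qed.

Lemma eq_fglift_on P (f g : K -> M) x : on P x ->
  (forall t, P t -> f t = g t) -> fglift f x = fglift g x.
Proof.
move=> Px fg; move: x Px; apply: on_span => [|k x y Hx Hy|t /fg].
- by rewrite !linear0.
- by rewrite !linearP /= Hx Hy.
- by rewrite !fglift1.
Qed.

Lemma fglift_eq0 P (f : K -> M) x : on P x ->
  (forall t, P t -> f t = 0) -> fglift f x = 0.
Proof.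
move=> Px fg; move: x Px; apply: on_span => [|k x y Hx Hy|t /fg].
- by rewrite linear0.
- by rewrite linearP /= Hx Hy scaler0 addr0.
- by rewrite fglift1.
Qed.

Lemma fglift_id_on P (f : K -> {freeg K}) x : on P x ->
  (forall t, P t -> f t = << t >>) -> fglift f x = x.
Proof.
move=> Px fg; move: x Px; apply: on_span => [|k x y Hx Hy|t /fg].
- by rewrite linear0.
- by rewrite linearP /= Hx Hy.
- by rewrite fglift1.
Qed.

End Supports.

Lemma on_fglift (K K' : choiceType) (P : K -> Prop) (Q : K' -> Prop)
    (f : K -> {freeg K'}) x :
  on P x -> (forall t, P t -> on Q (f t)) -> on Q (fglift f x).
Proof.
move=> Px Qf; move: x Px; apply: on_span => [|k x y Hx Hy|t /Qf].
- by rewrite linear0; apply: on0.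
- by rewrite linearP /=; apply: onP.
- by rewrite fglift1.
Qed.

Lemma fglift_comp (K K' : choiceType) (M : lmodType int)
    (f : K -> {freeg K'}) (g : K' -> M) x :
  fglift g (fglift f x) = fglift (fun t => fglift g (f t)) x.
Proof.
have : on (fun=> True) x by [].
move: x; apply: on_span => [|k x y Hx Hy|t _].
- by rewrite !linear0.
- by rewrite !linearP /= Hx Hy.
- by rewrite !fglift1.
Qed.

Section ListChains.
Variable e : ord.
Implicit Types (s t : seq e) (x y : {freeg (seq e)}) (w v : e -> int) (g : e).
Local Notation L := {freeg (seq e)}.

Definition prep a : L -> L := fglift (fun s => << a :: s >>).
HB.instance Definition _ a := GRing.Linear.on (prep a).

(* On increasing lists, contr w is interior multiplication by w and cone g is  *)
(* exterior multiplication by g; the boundary is contr (fun=> 1).              *)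
Fixpoint contr_seq w s : L :=
  if s is a :: s' then w a *: << s' >> - prep a (contr_seq w s') else 0.
Definition contr w : L -> L := fglift (contr_seq w).
HB.instance Definition _ w := GRing.Linear.on (contr w).

Fixpoint cone_seq g s : L :=
  if s is a :: s' then
    if (g < a)%O then << [:: g, a & s'] >>
    else if g == a then 0 else - prep a (cone_seq g s')
  else << [:: g] >>.
Definition cone g : L -> L := fglift (cone_seq g).
HB.instance Definition _ g := GRing.Linear.on (cone g).

Lemma prepU a s : prep a << s >> = << a :: s >>.
Proof. exact: fglift1. Qed.

Lemma contrU w s : contr w << s >> = contr_seq w s.
Proof. exact: fglift1. Qed.

Lemma coneU g s : cone g << s >> = cone_seq g s.
Proof. exact: fglift1. Qed.

Let trivial_on x : on (fun=> True) x. Proof. by []. Qed.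

Lemma contr_prep w a x : contr w (prep a x) = w a *: x - prep a (contr w x).
Proof.
move: x (@trivial_on x); apply: on_span => [|k x y Hx Hy|t _].
- by rewrite !(linear0, scaler0, subr0).
- by rewrite !linearP /= Hx Hy scalerDr addrACA.
- by rewrite prepU !contrU.
Qed.

(** Interior multiplications anticommute. With [v] the constant weight 1, contraction by any weight
    is a chain map up to sign. *)
Lemma contr_anti w v x : contr w (contr v x) = - contr v (contr w x).
Proof.
move: x (@trivial_on x); apply: on_span => [|k x y Hx Hy|t _].
- by rewrite !(linear0, oppr0).
- by rewrite !linearP /= Hx Hy.
rewrite !contrU; elim: t => [|a s IH] /=; first by rewrite !(linear0, oppr0).
rewrite !linearB !linearZ /= !contr_prep !contrU IH linearN /=.
by rewrite !opprK scalerN opprD addrA [_ - w a *: _]addrC -addrA.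
Qed.

Lemma contr_contr w x : contr w (contr w x) = 0.
Proof.
move: x (@trivial_on x); apply: on_span => [|k x y Hx Hy|t _].
- by rewrite !linear0.
- by rewrite !linearP /= Hx Hy /= scaler0 addr0.
rewrite !contrU; elim: t => [|a s IH] /=; first by rewrite !linear0.
by rewrite linearB linearZ /= contr_prep contrU IH linear0 subr0 subrr.
Qed.

Lemma cone_prep_lt g a x : (g < a)%O -> cone g (prep a x) = prep g (prep a x).
Proof.
move=> ga; move: x (@trivial_on x); apply: on_span => [|k x y Hx Hy|t _].
- by rewrite !linear0.
- by rewrite !linearP /= Hx Hy.
- by rewrite !prepU coneU /= ga.
Qed.

Lemma cone_prep_eq g x : cone g (prep g x) = 0.
Proof.
move: x (@trivial_on x); apply: on_span => [|k x y Hx Hy|t _].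
- by rewrite !linear0.
- by rewrite !linearP /= Hx Hy scaler0 addr0.
- by rewrite !prepU coneU /= ltxx eqxx.
Qed.

Lemma cone_prep_gt g a x : (a < g)%O ->
  cone g (prep a x) = - prep a (cone g x).
Proof.
move=> ag; move: x (@trivial_on x); apply: on_span => [|k x y Hx Hy|t _].
- by rewrite !(linear0, oppr0).
- by rewrite !linearP /= Hx Hy.
- by rewrite !prepU !coneU /= ltNge (ltW ag) /= gt_eqF.
Qed.

Lemma cone_seq_lt g s : path <%O g s -> cone_seq g s = << g :: s >>.
Proof. by case: s => [//|a s] /= /andP[-> _]. Qed.

(** The antiderivation rule $i_w(g\wedge x)=w(g)x-g\wedge i_w x$. The constant weight gives the cone
    homotopy [bd_cone]; the weight concentrated at [g] isolates the part of [x] containing [g]. *)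
Lemma contr_cone w g x : on (fun t => sorted <%O t) x ->
  contr w (cone g x) + cone g (contr w x) = w g *: x.
Proof.
move: x; apply: on_span => [|k x y Hx Hy|t st].
- by rewrite !(linear0, scaler0, addr0).
- by rewrite !linearP /= addrACA -scalerDr Hx Hy.
rewrite coneU contrU; elim: t st => [|a s IH] /= st.
  by rewrite contrU /= !(linear0, addr0, subr0, oppr0).
rewrite linearB linearZ /= coneU; case: ltgtP => [ga|ag|E].
- have gs : path <%O g s.
    by case: s st {IH} => [//|b s] /= /andP[ab ->]; rewrite (lt_trans ga ab).
  rewrite contrU /= cone_seq_lt // cone_prep_lt //.
  have -> : prep g (w a *: << s >> - prep a (contr_seq w s)) =
      w a *: << g :: s >> - prep g (prep a (contr_seq w s)).
    by rewrite linearB linearZ /= prepU.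
  by rewrite subrK.
- rewrite linearN /= contr_prep cone_prep_gt // opprK opprB addrA subrK.
  by rewrite -linearD /= IH ?(path_sorted st) // linearZ /= prepU.
- by subst a; rewrite linear0 cone_prep_eq subr0 add0r cone_seq_lt.
Qed.

Lemma contr_seq_on w s :
  on (fun t => subseq t s /\ (size t).+1 = size s) (contr_seq w s).
Proof.
elim: s => [|a s IH] /=; first exact: on0.
apply: onB.
  by apply: onZ; apply/onU; split=> //; exact: subseq_cons.
apply: on_fglift IH _ => t [ts st]; apply/onU; split=> /=; last by rewrite st.
by rewrite eqxx.
Qed.

Lemma cone_seq_on g s :
  on (fun t => [/\ (forall P, all P t = all P (g :: s)), g \in t,
       sorted <%O s -> sorted <%O t & size t = (size s).+1]) (cone_seq g s).
Proof.
elim: s => [|a s IH] /=.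
  by apply/onU; split=> //; rewrite mem_head.
case: ltgtP => [ga|ag|_]; last exact: on0.
  by apply/onU; split=> //=; [rewrite mem_head|rewrite ga].
apply: onN; apply: on_fglift IH _ => t [allt gt sst szt]; apply/onU.
split=> [P|||] /=; last by rewrite szt.
- by rewrite allt /= andbCA.
- by rewrite inE gt orbT.
rewrite !(path_sortedE (@lt_trans _ e)) => /andP[as_ ss].
by rewrite sst // allt /= ag as_.
Qed.

Lemma cone_seqE g s : cone_seq g s = 0 \/
  exists k t, cone_seq g s = (-1) ^+ k *: << t >>.
Proof.
elim: s => [|a s IH] /=; first by right; exists 0, [:: g]; rewrite scale1r.
case: ltgtP => [_|_|_]; last by left.
  by right; exists 0, [:: g, a & s]; rewrite scale1r.
case: IH => [->|[k [t ->]]]; first by left; rewrite linear0 oppr0.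
right; exists k.+1, (a :: t).
by rewrite linearZ /= prepU exprS mulN1r scaleNr.
Qed.

Lemma cone_seq_mem g s : sorted <%O s -> g \in s -> cone_seq g s = 0.
Proof.
elim: s => [//|a s IH] /= ps; rewrite inE; case: ltgtP => //= [ga|ag] gs.
  move: ps; rewrite (path_sortedE (@lt_trans _ e)) => /andP[/allP/(_ _ gs)].
  by rewrite ltNge (ltW ga).
by rewrite IH ?linear0 ?oppr0 ?(path_sorted ps).
Qed.

Lemma contr_seq_eq0 w s : all (fun a => w a == 0) s -> contr_seq w s = 0.
Proof.
elim: s => [//|a s IH] /= /andP[/eqP-> /IH->].
by rewrite scale0r linear0 subr0.
Qed.

(** Here [k] counts vertices, so the dimension is [k] minus one, and [k = 0] is the augmentation
    generated by the empty list. *)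
Definition simplex (k : nat) (A : set e) s :=
  [/\ sorted <%O s, size s = k & forall a, a \in s -> A a].

Definition bd : L -> L := contr (fun=> 1).
HB.instance Definition _ := GRing.Linear.on bd.

Lemma bd_cone g x k A : on (simplex k A) x -> bd (cone g x) = x - cone g (bd x).
Proof.
move=> xA; rewrite -[x in x - _]scale1r.
rewrite -(@contr_cone (fun=> 1) g x) ?addrK //.
by apply: on_sub xA => t [].
Qed.

Lemma contr_on w k (A : set e) x :
  on (simplex k.+1 A) x -> on (simplex k A) (contr w x).
Proof.
move=> xA; apply: on_fglift xA _ => s [ss sk sA].
apply: on_sub (@contr_seq_on w s) => t [ts st]; split.
- exact: subseq_sorted (@lt_trans _ e) _ _ ts ss.
- by move: st; rewrite sk => -[].
- by move=> a /(mem_subseq ts)/sA.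
Qed.

Lemma cone_on g k (A : set e) x : A g ->
  on (simplex k A) x -> on (simplex k.+1 A) (cone g x).
Proof.
move=> Ag xA; apply: on_fglift xA _ => s [ss sk sA].
apply: on_sub (@cone_seq_on g s) => t [allt _ sst st]; split.
- exact: sst.
- by rewrite st sk.
- have : all (fun a => `[< A a >]) t.
    rewrite allt /=; apply/andP; split; first exact/asboolP.
    by apply/allP => a /sA/asboolP.
  by move=> /allP tA a /tA/asboolP.
Qed.

Lemma simplex_sub k (A B : set e) s : (A `<=` B)%classic ->
  simplex k A s -> simplex k B s.
Proof. by move=> AB [? ? sA]; split=> // a /sA/AB. Qed.

Lemma simplex_min k (A : set e) (b : e) t : simplex k A (b :: t) ->
  forall c, c \in b :: t -> (b <= c)%O.
Proof.
move=> [/= pt _ _] c; rewrite inE => /predU1P[->//|ct]; apply: ltW.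
move: pt; rewrite (path_sortedE (@lt_trans _ e)).
by move=> /andP[/allP + _]; apply.
Qed.

End ListChains.

(** * Compatible bases of boundaries *)

Lemma seq_argmax (T : eqType) d (W : orderType d) (f : T -> W) (s : seq T) x0 :
  x0 \in s -> exists2 m, m \in s & forall x, x \in s -> (f x <= f m)%O.
Proof.
elim: s x0 => [//|a s IH] x0 _; case: s IH => [_|b s IH].
  by exists a; rewrite ?mem_head // => x; rewrite inE => /eqP->.
have [m ms maxm] := IH b (mem_head _ _).
have [am|ma] := leP (f a) (f m).
  by exists m => [|x]; rewrite in_cons ?ms ?orbT // => /predU1P[->|/maxm].
exists a; rewrite ?mem_head // => x; rewrite inE => /predU1P[->//|/maxm xm].
exact: le_trans xm (ltW ma).
Qed.

Lemma on_empty (K : choiceType) (P : K -> Prop) (x : {freeg K}) :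
  on P x -> (forall t, ~ P t) -> x = 0.
Proof.
move=> Px nP; apply/eqP; rewrite -dom_eq0; apply/eqP.
by move: Px; rewrite /on; case: (dom x) => [//|t s] /(_ t (mem_head _ _)) /nP.
Qed.

Lemma neq0_dom (K : choiceType) (x : {freeg K}) : x <> 0 -> exists t, t \in dom x.
Proof.
move/eqP; rewrite -dom_eq0; case E: (dom x) => [//|t s] _.
by exists t; rewrite mem_head.
Qed.

Section Acycles.
Variable e : ord.
Implicit Types (s t : seq e) (x y : {freeg (seq e)}) (a b : e) (A B : set e).

Definition tail A a : set e := [set b | A b /\ (a <= b)%O].

Lemma cycle_bounds k B x : on (simplex k.+1 B) x -> bd x = 0 ->
  exists2 y, on (simplex k.+2 B) y & bd y = x.
Proof.
move=> Bx x0; have [->|/neq0_dom[t tx]] := pselect (x = 0).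
  by exists 0; [exact: on0|rewrite linear0].
have [] := Bx t tx; case: t tx => [//|b t] _ _ _ /(_ b (mem_head _ _)) Bb.
exists (cone b x); first exact: cone_on.
by rewrite (bd_cone _ Bx) x0 linear0 subr0.
Qed.

Definition spanned (S : set (seq e)) x := exists2 c, on S c & bd c = bd x.

Lemma spanned0 S : spanned S 0.
Proof. by exists 0; first exact: on0. Qed.

Lemma spannedP S k x y : spanned S x -> spanned S y -> spanned S (k *: x + y).
Proof.
move=> [c Sc cx] [d Sd dy]; exists (k *: c + d); first exact: onP.
by rewrite !linearP /= cx dy.
Qed.

Definition above (S : set (seq e)) a : set (seq e) :=
  [set t | S t /\ forall b, b \in t -> (a <= b)%O].

(* The boundaries of S form a basis of the boundaries of simplices of A, and   *)
(* this remains true after restriction to every final segment [a, e).          *)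
Definition acycle k A (S : set (seq e)) : Prop :=
  [/\ forall t, S t -> simplex k A t,
      forall c, on S c -> bd c = 0 -> c = 0
    & forall a t, simplex k (tail A a) t -> spanned (above S a) << t >>].

Lemma acycle_spanned k A S a x : acycle k A S -> on (simplex k (tail A a)) x ->
  spanned (above S a) x.
Proof.
move=> [_ _ Sspan]; move: x; apply: on_span => [|k' x y|t]; first exact: spanned0.
  exact: spannedP.
exact: Sspan.
Qed.

Lemma bd1 a : bd << [:: a] >> = << [::] >> :> {freeg (seq e)}.
Proof. by rewrite /bd contrU /= linear0 subr0 scale1r. Qed.

(** In the augmented complex every point has the empty list as its boundary, so a single point
    spans; the greatest one lies in every nonempty final segment. *)
Lemma acycle_finite A : finite_set A -> exists S, acycle 1 A S.
Proof.
move=> /finite_seqP[s sA].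
have [[a0 Aa0]|A0] := pselect (exists a, A a); last first.
  exists set0; split=> [//|c c0 _|a t]; first by apply: (on_empty c0) => t [].
  case: t => [|b t] [_ // _ tA]; have [Ab _] := tA b (mem_head _ _).
  by case: A0; exists b.
have [m ms maxm] : exists2 m, m \in s & forall z : e, z \in s -> (z <= m)%O.
  by apply: (@seq_argmax _ _ e id s a0); move: Aa0; rewrite sA.
exists [set [:: m]]%classic; split=> [t ->|c cm|a t].
- by split=> // a; rewrite inE => /eqP->; rewrite sA.
- have [k ->] : exists k, c = k *: << [:: m] >>.
    move: c cm; apply: on_span => [|k x y [i ->] [j ->]|t ->].
    + by exists 0; rewrite scale0r.
    + by exists (k * i + j); rewrite scalerA scalerDl.
    + by exists 1; rewrite scale1r.
  rewrite linearZ /= bd1 => /(congr1 (coeff [::])).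
  by rewrite coeffZ coeffU eqxx coeff0 !mulr1 => ->; rewrite scale0r.
case: t => [|b [|b' t]] [_ // _ tA]; have [Ab ab] := tA b (mem_head _ _).
exists << [:: m] >>; last by rewrite !bd1.
apply/onU; split=> // a'; rewrite inE => /eqP->; apply: le_trans ab _.
by apply: maxm; move: Ab; rewrite sA.
Qed.

(** Contraction by this weight is the signed link of [b]: it deletes [b] from an increasing list and
    kills the lists that avoid [b]. *)
Definition delta b : e -> int := fun a => (a == b)%:R.

Lemma contr_delta_on b x : on (fun t => sorted <%O t) x ->
  on (fun t => b \notin t) (contr (delta b) x).
Proof.
move=> xs; apply: on_fglift xs _ => s /lt_sorted_uniq.
elim: s => [|a s IH] /=; first by move=> _; exact: on0.
move=> /andP[nas us]; rewrite {1}/delta; have [E|ab] := eqVneq a b.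
  subst b; rewrite contr_seq_eq0 ?linear0 ?addr0 ?scale1r; first exact/onU.
  by apply/allP => c cs; rewrite /delta (negPf (memPn nas c cs)).
rewrite scale0r sub0r; apply: onN; apply: on_fglift (IH us) _ => t bt.
by apply/onU; rewrite inE eq_sym (negPf ab).
Qed.

Lemma contr_delta_cone b k A s : simplex k A s -> ~ A b ->
  contr (delta b) (cone_seq b s) = << s >>.
Proof.
move=> [ss _ sA] nAb; have := @contr_cone e (delta b) b << s >>.
rewrite contrU contr_seq_eq0 ?linear0 ?addr0 ?coneU; last first.
  apply/allP => a /sA Aa; rewrite /delta; have [E|//] := eqVneq a b.
  by case: nAb; rewrite -E.
by rewrite /delta eqxx scale1r; apply; apply/onU.
Qed.

(** Independence: take the vertex of a relation that is greatest for [f]; its link is a relation in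
    the lower acycle, hence zero. Spanning: if [b] is the vertex of [t] greatest for [f] and [r] its
    signed link, replace [r] by a chain of the lower acycle with the same boundary; the difference
    is a cycle, filled among vertices before [b], where induction applies. *)
Lemma acycleS k A (W : ord) (f : e -> W) :
  (forall a b, A a -> A b -> f a = f b -> a = b) ->
  (forall b, A b -> exists S, acycle k.+1 [set c | A c /\ (f c < f b)%O] S) ->
  exists S, acycle k.+2 A S.
Proof.
move=> f_inj IHA; pose I b : set e := [set c : e | A c /\ (f c < f b)%O].
have /choice[T TP] b : exists S, A b -> acycle k.+1 (I b) S.
  by have [/IHA[S SP]|nAb] := pselect (A b); [exists S|exists set0].
have nIb b : ~ I b b by case; rewrite ltxx.
(* [cone_seq b s] is zero or a signed single list, so its domain picks out the increasing list on
   [s] together with [b], without the sign. *)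
pose S : set (seq e) :=
  [set t | exists b s, [/\ A b, T b s & t \in dom (cone_seq b s)]].
have SP t : S t -> exists b s, [/\ A b, T b s, b \in t,
    (forall a, a \in t -> a = b \/ a \in s)
    & exists j, contr (delta b) << t >> = (-1) ^+ j *: << s >>].
  move=> [b [s [Ab Ts ts]]]; exists b, s; split=> //.
  - by have [] := cone_seq_on ts.
  - have [allt _ _ _] := cone_seq_on ts.
    have : all (fun a => (a == b) || (a \in s)) t.
      by rewrite allt /= eqxx /=; apply/allP => a ->; rewrite orbT.
    by move=> /allP h a /h /orP[/eqP|]; [left|right].
  - have [h _ _] := TP b Ab; have := contr_delta_cone (h _ Ts) (nIb b).
    case: (cone_seqE b s) ts => [->|[j [t' ->]]]; first by rewrite dom0.
    rewrite domZ ?signr_eq0 // domU1 inE linearZ /= => /eqP-> <-.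
    by exists j; rewrite scalerA -expr2 sqrr_sign scale1r.
have SA t : S t -> simplex k.+2 A t.
  move=> [b [s [Ab Ts ts]]]; have [/(_ _ Ts) sI _ _] := TP b Ab.
  have sA : on (simplex k.+1 A) << s >>.
    by apply/onU; apply: simplex_sub sI => c [].
  by have /(_ t) := cone_on Ab sA; rewrite coneU; apply.
exists S; split=> [//|c Sc c0|a t].
- apply: contrapT => /neq0_dom[t0 t0c].
  have [b0 [_ [_ _ b0t0 _ _]]] := SP _ (Sc _ t0c).
  (* The vertex [b] is greatest for [f], not for the order of [e]. Any list of the relation
     containing [b] must therefore come from the cone over [T b]. *)
  have [|b bc maxb] := @seq_argmax _ _ W f (flatten (dom c)) b0.
    by apply/flattenP; exists t0.
  have {}maxb t a : t \in dom c -> a \in t -> (f a <= f b)%O.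
    by move=> tc at_; apply: maxb; apply/flattenP; exists t.
  have Ab : A b by move: bc => /flattenP[t /Sc/SA[_ _]]; apply.
  have [Tsub Tind _] := TP b Ab.
  have cT : on (T b) (contr (delta b) c).
    apply: (@on_fglift _ _ (fun t => t \in dom c)) => // t tc.
    have [bt|bt] := boolP (b \in t); last first.
      rewrite contr_seq_eq0; first exact: on0.
      by apply/allP => a at_; rewrite /delta (negPf (memPn bt a at_)).
    have [b' [s [Ab' Ts b't tsub [j]]]] := SP _ (Sc _ tc).
    have E : b' = b.
      have [//|bs] := tsub b bt.
      have [/(_ _ Ts) [_ _ /(_ b bs) [_ lt_bb']] _ _] := TP b' Ab'.
      by move: lt_bb'; rewrite ltNge (maxb _ _ tc b't).
    by subst b'; rewrite contrU => ->; apply: onZ; apply/onU.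
  have c00 : contr (delta b) c = 0.
    by apply: Tind => //; rewrite /bd contr_anti -/(bd c) c0 linear0 oppr0.
  have sc : on (fun t => sorted <%O t) c by move=> t /Sc/SA[].
  have := @contr_cone e (delta b) b c sc.
  rewrite c00 linear0 addr0 /delta eqxx scale1r => cE.
  move: bc => /flattenP[t tc bt]; move: tc; rewrite -cE.
  move=> /contr_delta_on; rewrite bt => /(_ _)/negP; apply=> //.
  by apply: on_sub (cone_on Ab (on_sub SA Sc)) => u [].
(* The induction is on a bound [w] for the [f]-values of the vertices; the final segment [a] refers
   to the original order and stays fixed. *)
have main (w : W) : forall t, simplex k.+2 (tail A a) t ->
    (forall c, c \in t -> (f c <= w)%O) -> spanned (above S a) << t >>.
  elim/ord_ind: w => w IH {}t tA tw.
  have [b bt maxb] : exists2 b, b \in t & forall c, c \in t -> (f c <= f b)%O.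
    case: t {tw} tA => [[] //|b0 t] _.
    exact: (@seq_argmax _ _ W f (b0 :: t) b0 (mem_head _ _)).
  have [st _ tA'] := tA; have [Ab ab] := tA' b bt.
  pose r := contr (delta b) << t >>.
  have tE : cone b r = << t >>.
    have := @contr_cone e (delta b) b << t >>.
    rewrite coneU cone_seq_mem // linear0 add0r /delta eqxx scale1r; apply.
    exact/onU.
  have rI : on (simplex k.+1 (tail (I b) a)) r.
    have h1 : on (simplex k.+1 [set c : e | tail A a c /\ (f c <= f b)%O]) r.
      apply: contr_on; apply/onU; split=> //; first by case: tA.
      by move=> c ct; split; [apply: tA'|apply: maxb].
    have h2 : on (fun t => b \notin t) r by apply: contr_delta_on; apply/onU.
    apply: on_sub (on_and h1 h2) => u [[su zu uA] bu]; split=> // c cu.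
    have [[Ac ac] cb] := uA c cu; split=> //; split=> //.
    rewrite lt_neqAle cb andbT; apply/eqP => /(f_inj _ _ Ac Ab) E.
    by move: bu; rewrite -E cu.
  have [c0 c0T c0r] := acycle_spanned (TP b Ab) rI.
  have c0I : on (simplex k.+1 (tail (I b) a)) c0.
    apply: on_sub c0T => u [Tu ua]; have [/(_ _ Tu) [su zu uI] _ _] := TP b Ab.
    by split=> // c cu; split; [apply: uI|apply: ua].
  have [y yI yE] : exists2 y, on (simplex k.+2 (tail (I b) a)) y & bd y = r - c0.
    by apply: cycle_bounds; [exact: onB|rewrite linearB /= c0r subrr].
  have [c2 c2S c2y] : spanned (above S a) y.
    move: y yI {yE}; apply: on_span => [|i x y|u uI]; first exact: spanned0.
      exact: spannedP.
    have [v vu maxv] : exists2 v, v \in u & forall c, c \in u -> (f c <= f v)%O.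
      case: u uI => [[] //|b0 u] _.
      exact: (@seq_argmax _ _ W f (b0 :: u) b0 (mem_head _ _)).
    apply: (IH (f v)) => //.
      have [_ _ /(_ v vu) [[_ vb] _]] := uI.
      exact: lt_le_trans vb (tw b bt).
    by apply: simplex_sub uI => c [[? ?] ?].
  exists (cone b c0 + c2).
    apply: onD => //; apply: on_fglift c0T _ => s [Ts sa] u us; split.
      by exists b, s.
    have [allt _ _ _] := cone_seq_on us.
    have : all (fun c => a <= c)%O u.
      by rewrite allt /= ab /=; apply/allP.
    by move=> /allP.
  rewrite linearD /= c2y yE (bd_cone _ c0I) c0r addrAC addrCA subrr addr0.
  by rewrite -(bd_cone _ rI) tE.
case: t => [[] //|b0 t] tA.
have [m _ maxm] := @seq_argmax _ _ W f (b0 :: t) b0 (mem_head _ _).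
exact: main tA maxm.
Qed.

End Acycles.

(** * Sections of the boundary map *)

Section Liftings.
Variable e : ord.
Implicit Types (s t : seq e) (x y : {freeg (seq e)}) (a b : e) (D : set e).
Local Notation L := {freeg (seq e)}.

(* fglift f is s o bd for a section s of bd over the boundaries of D that      *)
(* respects all final segments; bd s = id reads bd (fglift f x) = bd x, and    *)
(* the last clause says that s is well defined on boundaries.                  *)
Definition lifting k D (f : seq e -> L) : Prop :=
  [/\ forall t, simplex k D t -> forall a, (forall b, b \in t -> (a <= b)%O) ->
        on (simplex k (tail D a)) (f t),
      forall t, simplex k D t -> bd (f t) = bd << t >>
    & forall x, on (simplex k D) x -> bd x = 0 -> fglift f x = 0].

(** All points of [D] have the same boundary, so [f] takes one common value on them. It is nonzero,
    and its support would have to lie above every element of [D], although it consists of points of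
    [D], none of which is greatest. *)
Lemma no_lifting1 D f : D !=set0 ->
  (forall b, D b -> exists2 c, D c & (b < c)%O) -> ~ lifting 1 D f.
Proof.
move=> [b0 Db0] Dlim [f_tail f_bd f_cyc].
have s1 b : D b -> simplex 1 D [:: b].
  by move=> Db; split=> // a; rewrite inE => /eqP->.
have f_eq b : D b -> f [:: b] = f [:: b0].
  move=> Db; apply/eqP; rewrite -subr_eq0 -!(fglift1 f) -linearB; apply/eqP.
  apply: f_cyc; first by apply: onB; apply/onU; apply: s1.
  by rewrite linearB /= !bd1 subrr.
have [t tf] : exists t, t \in dom (f [:: b0]).
  apply: neq0_dom => f0; have := f_bd _ (s1 _ Db0).
  by rewrite f0 linear0 bd1 => /esym/freegU_neq0.
have [] := f_tail _ (s1 _ Db0) b0 _ t tf => [b|_].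
  by rewrite inE => /eqP->.
case: t tf => [//|b t] tf _ /(_ b (mem_head _ _))[/Dlim[c Dc bc] _].
move: tf; rewrite -(f_eq c Dc) => /(f_tail _ (s1 _ Dc) c)[c'|].
  by rewrite inE => /eqP->.
by move=> _ _ /(_ b (mem_head _ _))[_]; rewrite leNgt bc.
Qed.

(** * Restriction to a subset and the coefficient of its collapsed complement *)

Section Restrict.
Variable p : pred e.

Definition restr : L -> L := fglift (fun t => if all p t then << t >> else 0).
HB.instance Definition _ := GRing.Linear.on restr.

Definition outw (a : e) : int := (~~ p a)%:R.

Lemma restr_id x : on (all p) x -> restr x = x.
Proof. by move=> xp; apply: (fglift_id_on xp) => t ->. Qed.

Lemma restr_on k D x : on (simplex k D) x ->
  on (simplex k [set a | D a /\ p a]) (restr x).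
Proof.
move=> xD; apply: on_fglift xD _ => t [st zt tD].
case: allP => pt; last exact: on0.
by apply/onU; split=> // a at_; split; [apply: tD|apply: pt].
Qed.

Lemma contr_outw x : on (all p) x -> contr outw x = 0.
Proof.
move=> xp; apply: (fglift_eq0 xp) => t /allP pt; apply: contr_seq_eq0.
by apply/allP => a /pt; rewrite /outw => ->.
Qed.

Let all_contr_seq w t : all p t -> on (all p) (contr_seq w t).
Proof.
move=> /allP pt; apply: on_sub (@contr_seq_on _ w t) => u [ut _].
by apply/allP => a /(mem_subseq ut)/pt.
Qed.

Let restr_prep a x : restr (prep a x) = if p a then prep a (restr x) else 0.
Proof.
have : on (fun=> True) x by [].
move: x; apply: on_span => [|k x y Hx Hy|t _].
- by rewrite !linear0; case: ifP.
- by rewrite !linearP /= Hx Hy; case: ifP => // _; rewrite scaler0 addr0.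
- rewrite prepU /restr !fglift1 /=; case: (p a) => //=.
  by case: ifP; rewrite ?prepU ?linear0.
Qed.

(** A face with all vertices in [p] arises either from a list inside [p], or from a list with
    exactly one vertex outside by deleting that vertex. *)
Lemma restr_bd x : restr (bd x) = bd (restr x) + restr (contr outw x).
Proof.
have : on (fun=> True) x by [].
move: x; apply: on_span => [|k x y Hx Hy|t _].
- by rewrite !linear0 addr0.
- by rewrite !linearP /= Hx Hy addrACA -scalerDr.
have [pt|npt] := boolP (all p t).
  rewrite [restr << t >>]restr_id ?contr_outw ?linear0 ?addr0; try exact/onU.
  by rewrite restr_id // /bd contrU; apply: all_contr_seq.
rewrite [restr << t >>]fglift1 (negPf npt) linear0 add0r /bd !contrU.
elim: t npt => [//|a t IH] /=; rewrite !linearB !linearZ /= !restr_prep.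
rewrite negb_and /outw; case: ifP => /= [pa npt|_ _]; last by rewrite !subr0.
have /= -> := IH npt; congr (_ - _).
by rewrite /restr !fglift1 (negPf npt) !scaler0.
Qed.

(* Chain level map induced by collapsing the complement of p to one point      *)
(* lying beyond p, followed by the coefficient of that point.                  *)
Definition cofac x := restr (contr outw x).
HB.instance Definition _ := GRing.Linear.copy cofac (restr \o contr outw).

(** The correction term of [restr_bd] contains the contraction by [outw] twice and so vanishes. *)
Lemma bd_cofac x : bd (cofac x) = - cofac (bd x).
Proof.
rewrite /cofac /bd contr_anti linearN /= opprK -/bd.
by rewrite restr_bd contr_contr linear0 addr0.
Qed.

Lemma cofac_cone g x : ~~ p g -> on (fun t => sorted <%O t /\ all p t) x ->
  cofac (cone g x) = x.
Proof.
move=> pg xp; have x_p : on (all p) x by apply: on_sub xp => t [].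
have x_s : on (fun t => sorted <%O t) x by apply: on_sub xp => t [].
have := @contr_cone _ outw g x x_s; rewrite (contr_outw x_p).
rewrite linear0 addr0 /cofac => ->.
by rewrite /outw pg scale1r restr_id.
Qed.

Lemma cofac_eq0 x : on (all p) x -> cofac x = 0.
Proof. by move=> xp; rewrite /cofac contr_outw // linear0. Qed.

End Restrict.

(** The new section is $t\mapsto$ [cofac p (fglift f (cone g << t >>))]. Two facts make it work:
    [cofac] undoes coning from the outside vertex [g], and it kills chains inside [D'], in
    particular the values of [f] there. *)
Lemma lifting_pred k D D' g f : lifting k.+2 D f ->
  D' `<=` D -> D g -> (forall b, D' b -> (b < g)%O) ->
  (forall t, simplex k.+2 D' t -> on (simplex k.+2 D') (f t)) ->
  exists f', lifting k.+1 D' f'.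
Proof.
move=> [f_tail f_bd f_cyc] D'D Dg D'g f_cl.
pose p : pred e := fun a => `[< D' a >].
have pP m t : simplex m D' t -> all p t.
  by move=> [_ _ tD']; apply/allP => a /tD'/asboolP.
have pg : ~~ p g by apply/asboolP => /D'g; rewrite ltxx.
pose f' t := cofac p (fglift f (cone g << t >>)).
have f'E x : fglift f' x = cofac p (fglift f (cone g x)).
  have : on (fun=> True) x by [].
  move: x; apply: on_span => [|i x y Hx Hy|t _]; first by rewrite !linear0.
    by rewrite !linearP /= Hx Hy.
  by rewrite fglift1.
have coneD t : simplex k.+1 D' t -> on (simplex k.+2 D) (cone g << t >>).
  by move=> tD'; apply: cone_on => //; apply/onU; apply: simplex_sub tD'.
exists f'; split=> [t tD' a ta|t tD'|x xD' x0].
- have ag : (a <= g)%O.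
    case: t tD' ta => [[] //|b t] [_ _ /(_ b (mem_head _ _))/D'g bg].
    by move=> /(_ b (mem_head _ _)) ab; apply: le_trans ab (ltW bg).
  have : on (simplex k.+2 (tail D a)) (cone g << t >>).
    apply: cone_on => //; apply/onU; case: tD' => st zt tD'; split=> // b bt.
    by split; [apply/D'D/tD'|apply: ta].
  move=> /(@on_fglift _ _ _ (simplex k.+2 (tail D a)) f) h.
  have {}h : on (simplex k.+2 (tail D a)) (fglift f (cone g << t >>)).
    apply: h => u uD; apply: f_tail; first by apply: simplex_sub uD => b [].
    by move=> b bu; case: uD => _ _ /(_ b bu)[].
  have := restr_on (p := p) (contr_on (w := outw p) h).
  by apply: on_sub => u; apply: simplex_sub => b [[_ ab] /asboolP].
- have bdf : bd (fglift f (cone g << t >>)) = bd (cone g << t >>).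
    move: (cone _ _) (coneD t tD'); apply: on_span => [|i x y Hx Hy|u uD].
    + by rewrite !linear0.
    + by rewrite !linearP /= Hx Hy.
    + by rewrite fglift1 f_bd.
  have tD'' : on (simplex k.+1 D') << t >> by apply/onU.
  (* In $\partial(g\wedge t)=t-g\wedge\partial t$ the first term lies in [D'] and is killed; the
     second returns $\partial t$, its sign cancelling the one from [bd_cofac]. *)
  rewrite /f' bd_cofac bdf (bd_cone _ tD'') linearB /= cofac_eq0; last first.
    by apply/onU; apply: pP tD'.
  rewrite sub0r opprK cofac_cone //.
  by apply: on_sub (contr_on tD'') => u uD'; split; [case: uD'|apply: pP uD'].
- have [y yD' yx] := cycle_bounds xD' x0.
  (* Both the cone over the cycle [x] and its filling [y] inside [D'] have boundary [x], and [f]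
     depends only on boundaries. *)
  have E : fglift f (cone g x) = fglift f y.
    apply/eqP; rewrite -subr_eq0 -linearB; apply/eqP; apply: f_cyc.
      apply: onB; last by apply: on_sub yD' => u; apply: simplex_sub.
      by apply: cone_on => //; apply: on_sub xD' => u; apply: simplex_sub.
    by rewrite linearB /= (bd_cone _ xD') x0 linear0 subr0 yx subrr.
  rewrite f'E E cofac_eq0 //; apply: on_fglift yD' _ => u /f_cl.
  by apply: on_sub => v; apply: pP.
Qed.

End Liftings.

(** * Cardinality below aleph_n *)

Lemma choice_on (X Y : Type) (P : X -> Prop) (R : X -> Y -> Prop) :
  (exists x, P x) -> (forall x, P x -> exists y, R x y) ->
  exists f : X -> Y, forall x, P x -> R x (f x).
Proof.
move=> [x0 Px0] PR; have [y0 _] := PR x0 Px0.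
have /choice[f fP] x : exists y, P x -> R x y.
  by have [/PR[y Ry]|nP] := pselect (P x); [exists y|exists y0].
by exists f.
Qed.

Definition inj_on (T U : Type) (A : set T) (f : T -> U) :=
  forall x y, A x -> A y -> f x = f y -> x = y.

(** Cardinality below $\aleph_n$, expressed at a successor as at most $\aleph_m$ by an injection
    into some ordinal of type $\omega_m$. *)
Definition small (n : nat) (T : Type) (A : set T) : Prop :=
  if n is m.+1 then
    exists2 V, is_omega m V & exists f : T -> V, inj_on A f
  else finite_set A.

Lemma omega_infinite n V : is_omega n V -> infinite_set [set: V].
Proof.
elim: n V => [|n IH] V /=; first by case.
move=> [V0 /IH V0inf [V0V _]] Vfin; apply: V0V.
have /infiniteP h := V0inf; apply: card_le_trans h.
exact: finite_set_countable.
Qed.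

Lemma omega_nat n V : is_omega n V -> exists j : nat -> V, injective j.
Proof. by move=> /omega_infinite/infiniteP/card_le_setTP. Qed.

Lemma omega_inj n V V' : is_omega n V -> is_omega n V' ->
  exists f : V -> V', injective f.
Proof.
have le_inj (U U' : ord) : ord_le U U' -> exists f : U -> U', injective f.
  by move=> [f fm _]; exists f; exact: inc_inj.
elim: n V V' => [|n IH] V V' /=.
  by move=> [_ minV] [V'P _]; apply: le_inj; apply: minV.
move=> [e0 e0P [_ minV]] [e0' e0'P [V'P _]]; apply: le_inj; apply: minV.
move=> V'e0; apply: V'P; apply: card_le_trans V'e0 _.
exact/card_le_setTP/IH.
Qed.

Lemma omega_not_small n W : is_omega n W -> ~ small n [set: W].
Proof.
case: n => [|n] /=; first by case.
move=> [e0 e0P [We0 _]] [V VP [f f_inj]]; apply: We0; apply/card_le_setTP.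
have [g g_inj] := omega_inj VP e0P.
by exists (g \o f) => x y /g_inj; apply: f_inj.
Qed.

Lemma small_image n (T U : Type) (A : set T) (B : set U) (h : T -> U) :
  (forall u, B u -> exists2 t, A t & h t = u) -> small n A -> small n B.
Proof.
move=> BA; case: n => [|n] /=.
  move=> /(finite_image h); apply: sub_finite_set => u /BA[t At <-].
  by exists t.
move=> [V VP [f f_inj]]; exists V => //.
have [B0|nB] := pselect (exists u, B u); last first.
  have [j _] := omega_nat VP; exists (fun=> j 0%N) => x y Bx.
  by case: nB; exists x.
have [|k kP] := choice_on (R := fun u t => A t /\ h t = u) B0.
  by move=> u /BA[t]; exists t.
exists (f \o k) => x y Bx By /= fE.
have [Ax <-] := kP x Bx; have [Ay <-] := kP y By.
by rewrite (f_inj _ _ Ax Ay fE).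
Qed.

Lemma small_inj n (T U : Type) (A : set T) (B : set U) (g : U -> T) :
  (forall u, B u -> A (g u)) -> inj_on B g -> small n A -> small n B.
Proof.
move=> BA g_inj sA.
have [[u0 Bu0]|nB] := pselect (exists u, B u); last first.
  case: n sA => [_|n [V VP _]] /=.
    rewrite (_ : B = set0) //; apply/seteqP; split=> // u Bu.
    by case: nB; exists u.
  exists V => //; have [j _] := omega_nat VP; exists (fun=> j 0%N) => x y Bx.
  by case: nB; exists x.
have [||h hP] := choice_on (P := fun t => exists2 u, B u & g u = t)
    (R := fun t u => B u /\ g u = t).
- by exists (g u0), u0.
- by move=> t [u]; exists u.
apply: (small_image (h := h)) sA => u Bu; exists (g u); first exact: BA.
have [|Bh gh] := hP (g u); first by exists u.
exact: g_inj.
Qed.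

Lemma small_sub n (T : Type) (A B : set T) : B `<=` A -> small n A -> small n B.
Proof. by move=> BA; apply: (small_inj (g := id)). Qed.

Lemma mono_ge (W : ord) (f : W -> W) : {mono f : x y / (x <= y)%O} ->
  forall w, (w <= f w)%O.
Proof.
move=> fm; apply: ord_ind => w IH; rewrite leNgt; apply/negP => fw.
by have := IH _ fw; rewrite fm leNgt fw.
Qed.

Section Segment.
Variables (W : ord) (y : W).

Let R : rel {w : W | (w < y)%O} := fun u v => (val u <= val v)%O.

Let R_wo : well_order R.
Proof.
apply: antisymmetric_well_order => [u v|A [u Au]].
  by move=> /le_anti/val_inj.
have [|x [[z Az zx] minx]] :=
    @ord_min W (fun w => exists2 z, z \in A & val z = w).
  by exists (val u), u.
exists z; split=> // v Av; rewrite /R zx; apply: minx.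
by exists v.
Qed.

Definition segment : ord := ord_of_rel R_wo.

Lemma segment_not_le : ~ ord_le W segment.
Proof.
move=> [f fm _]; pose g (w : W) : W := val (f w : {w : W | (w < y)%O}).
have gm : {mono g : u v / (u <= v)%O} by move=> u v; exact: fm.
have := mono_ge gm y; rewrite leNgt /g.
by case: (f y : {w : W | (w < y)%O}) => z /= ->.
Qed.

(** Were a proper initial segment too large, leastness would embed [W] into it as an initial
    segment, against [segment_not_le]. *)
Lemma omega_segment n : is_omega n W -> small n [set w | (w < y)%O].
Proof.
have valE w : (w < y)%O -> exists2 u : {w : W | (w < y)%O}, True & val u = w.
  by move=> wy; exists (exist _ w wy).
case: n => [|n] /=.
  move=> [_ minW]; apply: contrapT => inf; apply: segment_not_le; apply: minW.
  move=> fin; apply: inf.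
  apply: sub_finite_set (finite_image (val : {w : W | (w < y)%O} -> W) fin).
  by move=> w /valE[u _ <-]; exists u.
move=> [e0 e0P [_ minW]].
have /card_le_setTP[f f_inj] : ([set: segment] #<= [set: e0])%card.
  by apply: contrapT => /minW/segment_not_le.
apply: (@small_image n.+1 _ _ [set: segment] _ (val : {w : W | (w < y)%O} -> W)).
  by move=> w /valE[u _ <-]; exists u.
by exists e0 => //; exists f => u v _ _ /f_inj.
Qed.

End Segment.

Lemma small_finite n (T : Type) (A : set T) : finite_set A -> small n A.
Proof.
case: n => [//|n] Afin; have [V VP] := is_omega_exists n.
exists V => //; have [j j_inj] := omega_nat VP.
have /pcard_leTP/unsquash f := finite_set_countable Afin.
exists (j \o f) => x y Ax Ay /j_inj; apply: (@inj _ _ _ f); exact/mem_set.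
Qed.

Definition squarable n :=
  forall V, is_omega n V -> exists q : V * V -> V, injective q.

(** Squaring is assumed only one index lower, so that this can be used inside the inductive proof of
    [omega_square]. *)
Lemma small_bigcup_of_sq n (I T : Type) (D : set I) (F : I -> set T) :
  (forall m, n = m.+1 -> squarable m) -> small n D ->
  (forall i, D i -> small n (F i)) -> small n (\bigcup_(i in D) F i).
Proof.
case: n => [|n] sq /=; first exact: bigcup_finite.
move=> [V VP [f f_inj]] smallF; exists V => //.
have [q q_inj] := sq n erefl V VP.
have [D0|nD] := pselect (exists i, D i); last first.
  have [j _] := omega_nat VP; exists (fun=> j 0%N) => x y [i Di].
  by case: nD; exists i.
have [i|g gP] := choice_on (R := fun i (h : T -> V) => inj_on (F i) h) D0.
  move=> /smallF[V' V'P [h h_inj]]; have [k k_inj] := omega_inj V'P VP.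
  by exists (k \o h) => x y Fx Fy /k_inj; apply: h_inj.
have [U0|nU] := pselect (exists x, (\bigcup_(i in D) F i) x); last first.
  have [j _] := omega_nat VP; exists (fun=> j 0%N) => x y Ux.
  by case: nU; exists x.
have [x|k kP] := choice_on (R := fun x i => D i /\ F i x) U0.
  by move=> [i Di Fx]; exists i.
exists (fun x => q (f (k x), g (k x) x)) => x y /kP[Dx Fx] /kP[Dy Fy].
move=> /q_inj[/(f_inj _ _ Dx Dy) E]; rewrite E in Fx *.
exact: gP.
Qed.

Lemma small_initial_of_sq n (W : ord) (y : W) :
  (forall m, n = m.+1 -> squarable m) -> is_omega n W ->
  small n [set w | (w <= y)%O].
Proof.
move=> sq WP; apply: (@small_sub n _ (\bigcup_(b in [set: bool])
    if b then [set w | (w < y)%O] else [set y])).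
  move=> w /=; rewrite le_eqVlt => /orP[/eqP->|wy]; first by exists false.
  by exists true.
apply: small_bigcup_of_sq => // [|[] _]; first by apply: small_finite.
  exact: omega_segment.
by apply: small_finite.
Qed.

Section Square.
Variables (n : nat) (W : ord).
Hypotheses (sq : forall m, n = m.+1 -> squarable m) (WP : is_omega n W).

Let top (p : W * W) := Order.max p.1 p.2.

Let small_square (y : W) : small n [set p | (top p <= y)%O].
Proof.
apply: (@small_sub n _ (\bigcup_(a in [set w | (w <= y)%O])
    [set p | p.1 = a /\ (p.2 <= y)%O])).
  by move=> p /=; rewrite /top ge_max => /andP[p1 p2]; exists p.1.
apply: small_bigcup_of_sq => // [|a _]; first exact: small_initial_of_sq.
apply: (@small_image n _ _ _ _ (fun b => (a, b))) (small_initial_of_sq y sq WP).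
by move=> [p1 p2] /= [-> p2y]; exists p2.
Qed.

(* Goedel's well-order: its proper initial segments lie in squares of initial  *)
(* segments of W.                                                              *)
Let R (p r : W * W) := (top p < top r)%O || (top p == top r) &&
  ((p.1 < r.1)%O || (p.1 == r.1) && (p.2 <= r.2)%O).

Let R_top p r : R p r -> (top p <= top r)%O.
Proof. by move=> /orP[/ltW|/andP[/eqP->]]. Qed.

Let R_wo : well_order R.
Proof.
apply: antisymmetric_well_order => [p r|A [p0 Ap0]].
  rewrite /R; case: ltgtP => //= _; case: ltgtP => //= E1 /le_anti.
  by case: p r E1 => [a b] [c d] /= -> ->.
have [|m [[p1 Ap1 <-] min1]] :=
    @ord_min W (fun w => exists2 p, p \in A & top p = w).
  by exists (top p0), p0.
have [|a [[p2 [Ap2 tp2 <-]] min2]] :=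
    @ord_min W (fun w => exists p, [/\ p \in A, top p = top p1 & p.1 = w]).
  by exists p1.1, p1.
have [|b [[p3 [Ap3 tp3 fp3 <-]] min3]] := @ord_min W (fun w => exists p,
    [/\ p \in A, top p = top p1, p.1 = p2.1 & p.2 = w]).
  by exists p2.2, p2.
exists p3; split=> // r Ar; rewrite /R tp3 fp3.
have := min1 (top r) (ex_intro2 _ _ r Ar erefl).
rewrite le_eqVlt => /orP[/eqP E1|->//]; rewrite -E1 ltxx eqxx /=.
have : (p2.1 <= r.1)%O by apply: min2; exists r.
rewrite le_eqVlt => /orP[/eqP E2|->//]; rewrite -E2 ltxx eqxx /=.
by apply: min3; exists r.
Qed.

(** Compare the square, well-ordered by [R], with [W]. If it did not embed, [W] would be isomorphic
    to a proper initial segment of it, hence would inject into a small square. *)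
Lemma omega_square_aux : exists q : W * W -> W, injective q.
Proof.
have [[f fm _]|[x [g [gm gx]]]] := ord_comparable (ord_of_rel R_wo) W.
  by exists f; exact: inc_inj fm.
exfalso; apply: (omega_not_small WP).
apply: (small_inj (g := g : W -> W * W)) (small_square (top (x : W * W))).
  move=> w _ /=; apply: R_top.
  by have /ltW : (g w < x)%O by apply/gx; exists w.
by move=> u v _ _ /(inc_inj gm).
Qed.

End Square.

Lemma omega_square n : squarable n.
Proof.
elim: n => [|n IH] W WP; first exact: omega_square_aux WP.
by apply: omega_square_aux WP => m [<-].
Qed.

Lemma small_bigcup n (I T : Type) (D : set I) (F : I -> set T) : small n D ->
  (forall i, D i -> small n (F i)) -> small n (\bigcup_(i in D) F i).
Proof. by apply: small_bigcup_of_sq => m _; apply: omega_square. Qed.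

(** A cofinality condition: no subset of size less than $\aleph_n$ is cofinal, with strict bounds
    found in [D] itself. *)
Definition big n (e : ord) (D : set e) : Prop := forall Y : set e,
  Y `<=` D -> small n Y -> exists2 g, D g & forall y, Y y -> (y < g)%O.

(** Regularity of $\omega_n$: an unbounded small set would make [W] a small union of small initial
    segments. *)
Lemma omega_big n W : is_omega n W -> big n [set: W].
Proof.
move=> WP Y _ Ysmall; apply: contrapT => nb; apply: (omega_not_small WP).
apply: (@small_sub n _ (\bigcup_(y in Y) [set w | (w <= y)%O])).
  move=> w _; apply: contrapT => nw; apply: nb; exists w => // y Yy.
  by rewrite ltNge; apply/negP => wy; apply: nw; exists y.
apply: small_bigcup => // y _.
by apply: small_initial_of_sq => // m _; apply: omega_square.
Qed.

Lemma omega_tree n W : is_omega n W ->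
  exists f : GenTree.tree W -> W, injective f.
Proof.
move=> WP; have [q q_inj] := omega_square WP; have [j j_inj] := omega_nat WP.
pose i (x : nat + W) := match x with
  | inl k => q (j 0%N, j k) | inr w => q (j 1%N, w) end.
have i_inj : injective i.
  by move=> [k|w] [k'|w'] /q_inj[] => [/j_inj->|/j_inj|/j_inj|->].
pose c := foldr (fun x w => q (i x, w)) (j 0%N).
have c_inj s t : size s = size t -> c s = c t -> s = t.
  elim: s t => [|x s IH] [|y t] //= [st] /q_inj[/i_inj-> /IH->//].
(* The length is coded in front, since [c] is injective only among lists of equal length. *)
exists (fun t => let s := GenTree.encode t in q (j (size s), c s)).
move=> t u /q_inj[/j_inj st /(c_inj _ _ st)].
exact: (pcan_inj (@GenTree.codeK W)).
Qed.

(** * Closures under finitary operations, and bounded closed subsets by transfinite recursion *)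

Section Closure.
Variables (T : eqType) (F : seq T -> seq T).

Inductive closure_of (Y : set T) : T -> Prop :=
| closure_base x : Y x -> closure_of Y x
| closure_step t x : (forall y, y \in t -> closure_of Y y) -> x \in F t ->
    closure_of Y x.

Lemma closure_mono (Y Z : set T) : Y `<=` Z ->
  forall x, closure_of Y x -> closure_of Z x.
Proof.
move=> YZ x; elim=> [z /YZ|t z _ IH zt]; first exact: closure_base.
by apply: closure_step zt.
Qed.

Lemma closure_sub (Y D : set T) : Y `<=` D ->
  (forall t, (forall y, y \in t -> D y) -> forall x, x \in F t -> D x) ->
  forall x, closure_of Y x -> D x.
Proof.
move=> YD DF x; elim=> [z /YD //|t z _ IH zt].
by apply: DF zt.
Qed.

Lemma seq_choice (X : Type) (P : T -> X -> Prop) (t : seq T) :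
  (forall y, y \in t -> exists x, P y x) ->
  exists s : seq X, size s = size t /\
    forall x0 y0 i, (i < size t)%N -> P (nth y0 t i) (nth x0 s i).
Proof.
elim: t => [|y t IH] tP; first by exists [::].
have [x Px] := tP y (mem_head _ _).
have [z zt|s [st sP]] := IH; first by apply: tP; rewrite inE zt orbT.
by exists (x :: s); split=> [|x0 y0 [|i]] /=; rewrite ?st // => /sP; apply.
Qed.

(* Every element of the closure is the value of a finite tree: a leaf w stands *)
(* for h w, and a node labelled i for the i-th entry of F at its subtrees.     *)
Lemma closure_small n (W : ord) (Y : set T) (h : W -> T) : is_omega n W ->
  (forall y, Y y -> exists w, h w = y) -> small n.+1 (closure_of Y).
Proof.
move=> WP Yh; have [j _] := omega_nat WP; have [f f_inj] := omega_tree WP.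
pose fix ev (t : GenTree.tree W) : T := match t with
  | GenTree.Leaf w => h w
  | GenTree.Node i ts => nth (h (j 0%N)) (F (map ev ts)) i
  end.
apply: (@small_image n.+1 _ _ [set: GenTree.tree W] _ ev); last first.
  by exists W => //; exists f => t u _ _ /f_inj.
move=> x; elim=> [z /Yh[w <-]|t z _ IH zt]; first by exists (GenTree.Leaf w).
have [y yt|s [st sP]] := @seq_choice _ (fun y u => ev u = y) t.
  by have [u _ <-] := IH y yt; exists u.
exists (GenTree.Node (index z (F t)) s) => //=.
rewrite (_ : map ev s = t) ?nth_index //.
apply: (@eq_from_nth _ z); rewrite size_map // => i lti.
by rewrite (nth_map (GenTree.Leaf (j 0%N))) // (sP _ z) // -st.
Qed.

End Closure.

Lemma ord_rec (W : ord) (X : Type) (G : forall w : W, (W -> X) -> X) :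
  (forall w f g, (forall v, (v < w)%O -> f v = g v) -> G w f = G w g) ->
  X -> exists f : W -> X, forall w, f w = G w f.
Proof.
move=> Gloc x0.
have wf : well_founded (fun v w : W => (v < w)%O).
  by apply: ord_ind => w IH; constructor.
pose step w (rec : forall v, (v < w)%O -> X) : X :=
  G w (fun v => if boolP (v < w)%O is AltTrue h then rec v h else x0).
exists (Fix wf (fun=> X) step) => w.
rewrite Fix_eq => [|v r s rs]; first last.
  by congr step; apply: functional_extensionality_dep => u;
     apply: functional_extensionality_dep => h.
apply: Gloc => v vw.
by case: {-}_ / boolP => //; rewrite vw.
Qed.

(** Build an increasing sequence of length $\omega_n$ in [D], each term bounding the closure of the
    earlier ones, and let [D'] be the closure of its range. A small subset of [D'] already lies in
    the closure of a proper initial part, which the next terms bound; [D'] itself has at most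
    $\aleph_n$ elements and so is bounded in [D]. *)
Lemma big_closed_subset n (e : ord) (D : set e) (F : seq e -> seq e) :
  big n.+1 D ->
  (forall t, (forall y, y \in t -> D y) -> forall x, x \in F t -> D x) ->
  exists D' : set e, [/\ D' `<=` D, big n D',
    forall t, (forall y, y \in t -> D' y) -> forall x, x \in F t -> D' x
    & exists2 g, D g & forall y, D' y -> (y < g)%O].
Proof.
move=> Dbig DF; have [W WP] := is_omega_exists n.
have [d0 Dd0 _] : exists2 g, D g & forall y : e, set0 y -> (y < g)%O.
  by apply: Dbig => //; apply: small_finite.
pose bounds (Y : set e) g := D g /\ forall y, Y y -> (y < g)%O.
have /choice[ub ubP] Y : exists g, (exists g, bounds Y g) -> bounds Y g.
  by have [[g Yg]|nY] := pselect (exists g, bounds Y g); [exists g|exists d0].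
pose C (f : W -> e) w := closure_of F [set y | exists2 v, (v < w)%O & f v = y].
have [||f fE] := @ord_rec W e (fun w f => ub (C f w)).
- move=> w f g fg; congr ub; congr closure_of; apply/seteqP.
  by split=> y [v vw <-]; exists v; rewrite ?fg.
- exact: d0.
have fP w : bounds (C f w) (f w).
  elim/ord_ind: w => w IH; rewrite fE; apply: ubP.
  have [||g Dg Cg] := Dbig (C f w); last by exists g.
  - by apply: closure_sub => // y [v /IH[Dv _] <-].
  - by apply: (@closure_small _ F n W _ f WP) => y [v _ <-]; exists v.
pose D' := closure_of F [set y | exists w, f w = y].
have D'D : D' `<=` D by apply: closure_sub => // y [w <-]; have [] := fP w.
have D'C : forall y, D' y -> exists w, C f w y.
  have Wbig := omega_big WP.
  have next (w : W) : exists2 v, setT v & forall u, [set w] u -> (u < v)%O.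
    by apply: Wbig => //; apply: small_finite.
  move=> ?; elim=> [z [w <-]|t z _ IH zt].
    have [v _ /(_ w erefl) wv] := next w.
    by exists v; apply: closure_base; exists w.
  have [w wP] : exists w, forall y, y \in t -> C f w y.
    elim: t IH {zt} => [|x t IHt] IH.
      by have [j _] := omega_nat WP; exists (j 0%N).
    have [y yt|w wP] := IHt; first by apply: IH; rewrite inE yt orbT.
    have [v vP] := IH x (mem_head _ _).
    have Cmono (u u' : W) : (u <= u')%O -> forall y, C f u y -> C f u' y.
      move=> uu'; apply: closure_mono => y' [a au <-].
      by exists a => //; apply: lt_le_trans uu'.
    exists (Order.max w v) => y'; rewrite inE => /predU1P[->|/wP].
      by apply: Cmono vP; rewrite le_max lexx orbT.
    by apply: Cmono; rewrite le_max lexx.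
  by exists w; apply: closure_step zt.
exists D'; split=> // [Y YD' Ysmall|t tD' x xt|].
- have [[y0 Yy0]|nY] := pselect (exists y, Y y); last first.
    have [j _] := omega_nat WP; exists (f (j 0%N)) => [|y Yy].
      by apply: closure_base; exists (j 0%N).
    by case: nY; exists y.
  (* [r y] is a stage by which [y] has appeared. These stages form a small set, bounded in [W] by
     some [w], and [f w] then bounds [Y]. *)
  have [|y|r rP] := choice_on (P := Y) (R := fun y w => C f w y).
  - by exists y0.
  - by move=> /YD'/D'C.
  have [||w _ wP] := omega_big WP (Y := [set w | exists2 y, Y y & r y = w]) => //.
    by apply: small_image Ysmall => w [y Yy <-]; exists y.
  exists (f w) => [|y Yy]; first by apply: closure_base; exists w.
  apply: (fP w).2; apply: closure_mono (rP y Yy) => z [v vr <-].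
  by exists v => //; apply: lt_trans vr _; apply: wP; exists y.
- exact: closure_step xt.
- apply: Dbig => //.
  by apply: (@closure_small _ F n W _ f WP) => y [w <-]; exists w.
Qed.

Lemma no_lifting n (e : ord) (D : set e) f : big n D -> ~ lifting n.+1 D f.
Proof.
elim: n D f => [|n IH] D f Dbig fl.
  apply: no_lifting1 fl.
    have [//|//|g Dg _] := Dbig set0; first exact: finite_set0.
    by exists g.
  move=> b Db; have [||g Dg bg] := Dbig [set b]; last first.
  - by exists g => //; apply: bg.
  - exact: finite_set1.
  - by move=> _ ->.
have [f_tail _ _] := fl.
have f_D t : simplex n.+2 D t -> on (simplex n.+2 D) (f t).
  case: t => [[]//|a t] tD; have /(_ _ tD a) h := f_tail.
  have {}h : on (simplex n.+2 (tail D a)) (f (a :: t)).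
    exact/h/(simplex_min tD).
  by apply: on_sub h => u; apply: simplex_sub => b [].
(* The vertices occurring in [f t]: a set closed under [F] is closed under the section, as
   [lifting_pred] demands. *)
pose F t := if `[< simplex n.+2 D t >] then flatten (dom (f t)) else [::].
have [|D' [D'D D'big D'F [g Dg D'g]]] := @big_closed_subset n e D F Dbig.
  move=> t tD x; rewrite /F; case: asboolP => // /f_D tD'.
  by move=> /flattenP[u /tD'[_ _]]; apply.
have [f' f'l] : exists f', lifting n.+1 D' f'; last exact: IH f'l.
apply: (lifting_pred fl D'D Dg D'g) => t tD'.
have tD : simplex n.+2 D t by apply: simplex_sub tD'.
move=> u ut; have [su zu _] := f_D t tD u ut; split=> // a au.
have [_ _ /D'F] := tD'; apply; rewrite /F; case: asboolP => // _.
by apply/flattenP; exists u.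
Qed.

(** * The inverse systems d_n P_n *)

Lemma reduced_perm_eq (K : choiceType) (s s' : seq (int * K)) :
  reduced s -> reduced s' -> [freeg s] = [freeg s'] -> perm_eq s s'.
Proof.
move=> rs rs' E; have := @freegequivP int K s s' rs rs'; rewrite /fgequiv /=.
by case=> // nE; case: nE => x; rewrite -!coeff_Freeg E.
Qed.

(** * Passage between increasing tuples and lists *)

Section Embedding.
Variable e : ord.
Local Notation L := {freeg (seq e)}.

Definition to_list k : chains e k -> L :=
  fglift (fun t : incr e k => << val t : seq e >>).
HB.instance Definition _ k := GRing.Linear.on (@to_list k).

Definition of_list_seq k (s : seq e) : chains e k :=
  if insub s : option (k.-tuple e) is Some u then
    if insub u : option (incr e k) is Some t then << t >> else 0
  else 0.
Definition of_list k : L -> chains e k := fglift (@of_list_seq k).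
HB.instance Definition _ k := GRing.Linear.on (@of_list k).

Lemma to_listK k (x : chains e k) : of_list k (to_list x) = x.
Proof.
rewrite /of_list fglift_comp; apply: (@fglift_id_on _ (fun=> True)) => // t _.
by rewrite fglift1 /of_list_seq !valK.
Qed.

Lemma to_list_inj k : injective (@to_list k).
Proof. exact: can_inj (@to_listK k). Qed.

Lemma of_list_seqE k s : simplex k setT s ->
  exists2 t : incr e k, val t = s :> seq e & of_list_seq k s = << t >>.
Proof.
move=> [ss sk _]; have /eqP sk' := sk.
pose u := Tuple sk'; pose t := @Incr e k u ss; exists t => //.
by rewrite /of_list_seq -{1}[s]/(val u) valK -{1}[u]/(val t) valK.
Qed.

Lemma of_listK k (x : L) : on (simplex k setT) x -> to_list (of_list k x) = x.
Proof.
move=> xk; rewrite /to_list fglift_comp; apply: (fglift_id_on xk) => s.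
by move=> /of_list_seqE[t <- ->]; rewrite fglift1.
Qed.

Lemma chains_in_to_list k (a : e) (x : chains e k) :
  x \in chains_in [pred b : e | (a <= b)%O] ->
  on (simplex k (tail setT a)) (to_list x).
Proof.
move=> /allP xa; apply: (@on_fglift _ _ (fun t => t \in dom x)) => // t.
move=> /xa/allP ta.
apply/onU; split; [exact: (valP t)|exact: size_tuple|].
by move=> b /ta.
Qed.

Lemma chains_in_of_list k (a : e) (x : L) :
  on (simplex k (tail setT a)) x ->
  of_list k x \in chains_in [pred b : e | (a <= b)%O].
Proof.
move=> xa; apply/allP => t.
suff h : on (fun t : incr e k => forall b, b \in (val t : seq e) -> (a <= b)%O)
    (of_list k x) by move=> /h ta; apply/allP => b /ta.
apply: on_fglift xa _ => s sa; have [//|u us ->] := @of_list_seqE k s.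
  by apply: simplex_sub sa.
by apply/onU => b; rewrite us => bs; have [_ _ /(_ b bs)[]] := sa.
Qed.

Lemma contr_seq1E (s : seq e) : contr_seq (fun=> 1) s =
  \sum_(i < size s) (-1) ^+ i *: << take i s ++ drop i.+1 s >>.
Proof.
elim: s => [|a s IH] /=; first by rewrite big_ord0.
rewrite big_ord_recl /= drop0 expr0 IH linear_sum -sumrN; congr (_ + _).
apply: eq_bigr => i _; rewrite linearZ /= prepU /bump /= add1n exprS mulN1r.
by rewrite scaleNr.
Qed.

Lemma val_omit k (t : incr e k.+1) (i : 'I_k.+1) :
  val (omit t i) = take i (val t) ++ drop i.+1 (val t) :> seq e.
Proof.
have x0 : e := tnth t i.
have szt : size (val t : seq e) = k.+1 by exact: size_tuple.
apply: (@eq_from_nth _ x0).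
  rewrite size_tuple size_cat size_takel ?size_drop szt; last exact: ltnW.
  by rewrite subSS subnKC // -ltnS.
move=> j; rewrite size_tuple => jk; rewrite -[j]/(val (Ordinal jk)) -tnth_nth.
rewrite tnth_mktuple (tnth_nth x0) /= nth_cat size_takel ?szt; last exact: ltnW.
rewrite /bump; case: leqP => ij; last by rewrite add0n nth_take.
by rewrite nth_drop add1n addSn subnKC.
Qed.

Lemma to_list_bdry k (x : chains e k.+1) : to_list (bdry x) = bd (to_list x).
Proof.
rewrite /to_list /bdry /bd /contr !fglift_comp.
apply: (@eq_fglift_on _ _ (fun=> True)) => // t _.
rewrite fglift1 contr_seq1E linear_sum (size_tuple (val t)).
by apply: eq_bigr => i _; rewrite linearZ /= fglift1 -val_omit.
Qed.

End Embedding.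

(** * Freeness of the inverse system restated as an ordinary basis *)

Section Free.
Variables (e : ord) (n : nat).
Local Notation K := {b : e & dP_term n b}.
Implicit Types (B : forall b : e, set (dP_term n b)) (z : {freeg K}).

Definition ev : {freeg K} -> chains e n := fglift (fun p => dP_val (tagged p)).
HB.instance Definition _ := GRing.Linear.on ev.

Section Level.
Variable a : e.
Local Notation Ka := {b : {b : e | (a <= b)%O} & dP_term n (val b)}.

Let forget (q : Ka) : K := Tagged (dP_term n) (tagged q).

Let retag (p : K) : Ka :=
  if boolP (a <= tag p)%O is AltTrue h
  then existT (fun b : {b : e | (a <= b)%O} => dP_term n (val b))
         (exist _ (tag p) h) (tagged p)
  else existT (fun b : {b : e | (a <= b)%O} => dP_term n (val b))
         (exist _ a (lexx a)) 0.

Let retagK p : (a <= tag p)%O -> forget (retag p) = p.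
Proof. by case: p => b y ab; rewrite /retag; case: {-}_ / boolP; rewrite ?ab. Qed.

Let forget_inj : injective forget.
Proof.
move=> [[b hb] y] [[c hc] y']; rewrite /forget /Tagged /= => E.
have Ebc : b = c := congr1 (@projT1 _ _) E; subst c.
by rewrite (bool_irrelevance hb hc) (eq_from_Tagged E).
Qed.

Definition forget_seq (s : seq (int * Ka)) := [seq (p.1, forget p.2) | p <- s].

Lemma dom_forget s p : p \in dom [freeg forget_seq s] ->
  exists2 q, q \in s & p = forget q.2.
Proof.
rewrite mem_dom coeff_Freeg => /eqP pc; apply/mapP.
rewrite (_ : map _ _ = predom (forget_seq s)); last first.
  by rewrite /predom /forget_seq -map_comp.
by apply: contrapT => /negP/(@precoeff_outdom int) /pc.
Qed.

Lemma reduced_forget s : reduced (forget_seq s) = reduced s.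
Proof.
rewrite /reduced /forget_seq -map_comp all_map.
by rewrite (map_comp forget snd) (map_inj_uniq forget_inj).
Qed.

Lemma ev_forget s : ev [freeg forget_seq s] =
  dP_val (\sum_(p <- s) bond (dP e n) (valP (tag p.2)) (tagged p.2) *~ p.1).
Proof.
rewrite /ev fglift_Freeg /prelift big_map.
elim: s => [|p s IH]; first by rewrite !big_nil.
rewrite !big_cons IH -[p.1 in LHS]intz scaler_int.
rewrite -[RHS]/(\val (_ : dP_term n a)) raddfD /=; congr (_ + _).
by rewrite -[RHS]/(\val (_ : dP_term n a)) raddfMz.
Qed.

Lemma dec_forget B (y : dP_term n a) s : decomposition (X := dP e n) B y s <->
  [/\ reduced (forget_seq s),
      on (fun p => B (tag p) (tagged p)) [freeg forget_seq s]
    & ev [freeg forget_seq s] = dP_val y].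
Proof.
rewrite reduced_forget ev_forget; split=> [[rs sB ->]|[rs sB yE]].
  by split=> // p /dom_forget[q /sB qB ->].
split=> // [p ps|]; last exact/val_inj/esym.
suff /sB : forget p.2 \in dom [freeg forget_seq s] by [].
rewrite mem_dom coeff_Freeg (@precoeff_mem_uniqE _ _ _ (p.1, forget p.2)).
- by have /andP[_ /allP/(_ _ ps)] := rs.
- by apply: reduced_uniq; rewrite reduced_forget.
- by apply/mapP; exists p.
Qed.

Lemma dec_of_freeg B (y : dP_term n a) z :
  on (fun p => B (tag p) (tagged p) /\ (a <= tag p)%O) z -> ev z = dP_val y ->
  exists2 s, decomposition (X := dP e n) B y s & [freeg forget_seq s] = z.
Proof.
move=> zB zy; pose s := [seq (coeff p z, retag p) | p <- dom z].
have sE : forget_seq s = [seq (coeff p z, p) | p <- dom z].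
  rewrite /forget_seq -map_comp; apply/eq_in_map => p /zB[_ ab] /=.
  by rewrite retagK.
have sz : [freeg forget_seq s] = z by rewrite sE Freeg_dom.
exists s => //; apply/dec_forget; rewrite sz; split=> //.
  rewrite sE /reduced -map_comp map_id_in // uniq_dom all_map /=.
  by apply/allP => p; rewrite mem_dom.
by move=> p /zB[].
Qed.

Lemma dec_inj B (y : dP_term n a) s s' :
  decomposition (X := dP e n) B y s -> decomposition (X := dP e n) B y s' ->
  [freeg forget_seq s] = [freeg forget_seq s'] -> perm_eq s s'.
Proof.
move=> /dec_forget[rs _ _] /dec_forget[rs' _ _] /(reduced_perm_eq rs rs').
have inj : injective (fun p : int * Ka => (p.1, forget p.2)).
  move=> [i p] [j q] E.
  by have := congr1 snd E; have := congr1 fst E => /= -> /forget_inj->.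
exact: perm_map_inj.
Qed.

End Level.

Definition is_basis B : Prop :=
  (forall a (y : dP_term n a),
     exists2 z, on (fun p => B (tag p) (tagged p) /\ (a <= tag p)%O) z
       & ev z = dP_val y) /\
  (forall z, on (fun p => B (tag p) (tagged p)) z -> ev z = 0 -> z = 0).

(** All bonding maps are inclusions, so reduced decompositions correspond to elements of the free
    group on pairs of a level and an element. Uniqueness becomes one linear independence statement
    across all levels. *)
Lemma free_dPP : free_invsys (dP e n) <-> exists B, is_basis B.
Proof.
split=> [[B BP]|[B [Bspan Bfree]]]; exists B; last first.
  move=> a y; have [z zB zy] := Bspan a y.
  have [s sP sz] := dec_of_freeg zB zy; exists s => // s' s'P.
  apply: (dec_inj sP s'P); apply/eqP; rewrite -subr_eq0; apply/eqP.
  move: sP s'P => /dec_forget[_ sB sy] /dec_forget[_ s'B s'y].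
  by apply: Bfree; [exact: onB|rewrite linearB /= sy s'y subrr].
split=> [a y|z zB z0].
  have [s /dec_forget[_ sB sy] _] := BP a y.
  exists [freeg forget_seq s] => //; apply: on_and => // p.
  by move=> /dom_forget[q _ ->]; exact: (valP (tag q.2)).
apply: contrapT => /neq0_dom[p pz].
(* At the least level of [e] every generator is admissible, so the relation [z] becomes a
   decomposition of 0 there, to be compared with the empty one. *)
have [a [_ mina]] := @ord_min e (fun=> True) (ex_intro _ (tag p) I).
have zB' : on (fun p => B (tag p) (tagged p) /\ (a <= tag p)%O) z.
  by move=> q /zB; split=> //; apply: mina.
have [s sP sz] := @dec_of_freeg a B 0 z zB' z0.
have [s0 _ s0P] := BP a 0.
have nilP : decomposition (X := dP e n) B (0 : dP_term n a) [::].
  by split=> //; rewrite big_nil.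
have : perm_eq s [::] by rewrite -(permPl (s0P _ sP)) s0P.
move=> /perm_nilP s_nil; move: pz; rewrite -sz s_nil freeg_nil dom0.
by [].
Qed.

End Free.

(** * Bases from acycles, sections from bases, and the conclusion *)

Lemma bdry_dP (e : ord) n (b : e) (x : {freeg (seq e)}) :
  on (simplex n.+1 (tail setT b)) x ->
  exists y : dP_term n b, dP_val y = bdry (of_list n.+1 x).
Proof.
move=> xb.
have h : bdry (of_list n.+1 x) \in dP_pred b.
  by apply/asboolP; exists (of_list n.+1 x) => //; apply: chains_in_of_list.
by exists (DPTerm h).
Qed.

Lemma acycle_free (e : ord) n (S : set (seq e)) :
  acycle n.+1 setT S -> free_invsys (dP e n).
Proof.
move=> Sac; have [Ssub Sind _] := Sac; apply/free_dPP.
pose K : choiceType := {b : e & dP_term n b}.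
(* Each boundary of a member [t] of [S] is placed at the level of the least vertex of [t], the
   highest term sure to contain it; it then serves every final segment containing [t]. *)
pose Rel (p : K) t := [/\ S t, tag p \in t, forall c, c \in t -> (tag p <= c)%O
  & to_list (dP_val (tagged p)) = bd << t >>].
have Rel_ex t : S t -> exists p, Rel p t.
  move=> St; have tT := Ssub _ St; case: t St tT => [_ [] //|b t] St tT.
  have minb := simplex_min tT.
  have [y yE] : exists y : dP_term n b,
      dP_val y = bdry (of_list n.+1 << b :: t >>).
    apply: bdry_dP; apply/onU; case: tT => st zt _.
    by split=> // c ct; split=> //; apply: minb.
  exists (Tagged (dP_term n) y); split=> //; first exact: mem_head.
  by rewrite /= yE to_list_bdry of_listK //; apply/onU.
have Rel_inj p p' t : Rel p t -> Rel p' t -> p = p'.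
  case: p p' => [b y] [b' y'] [/= _ bt bmin yE] [/= _ bt' bmin' yE'].
  have E : b = b' by apply: le_anti; rewrite bmin // bmin'.
  subst b'; congr existT; apply: val_inj.
  by apply: to_list_inj; rewrite /= yE.
have /choice[zt ztP] t : exists z : {freeg K},
    S t -> exists2 p, z = << p >> & Rel p t.
  have [/Rel_ex[p pt]|nSt] := pselect (S t); last by exists 0.
  by exists << p >> => _; exists p.
exists (fun b => [set y | exists t, Rel (Tagged (dP_term n) y) t]); split.
  move=> a y; have [r ra yr] : exists2 r : chains e n.+1,
      r \in chains_in [pred b : e | (a <= b)%O] & dP_val y = bdry r.
    exact/asboolP/(valP y).
  have [c cS cr] := acycle_spanned Sac (chains_in_to_list ra).
  exists (fglift zt c).
    apply: on_fglift cS _ => t [St ta]; have [[b x] -> pt] := ztP t St.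
    apply/onU; split; first by exists t.
    by apply: ta; have [] := pt.
  apply: to_list_inj; rewrite yr to_list_bdry -cr /ev /to_list !fglift_comp.
  apply: (eq_fglift_on cS) => t [St _]; have [p -> [_ _ _ pE]] := ztP t St.
  by rewrite fglift1 -[fglift _ _]/(to_list _) pE /bd contrU.
move=> z zB z0.
have /choice[T TP] (p : K) : exists t, (exists t, Rel p t) -> Rel p t.
  by have [[t pt]|np] := pselect (exists t, Rel p t); [exists t|exists [::]].
have {}zB : on (fun p : K => Rel p (T p)) z.
  by apply: on_sub zB => -[b y] [t yt]; apply: TP; exists t.
pose c : {freeg (seq e)} := fglift (fun p => << T p >>) z.
have c0 : c = 0.
  apply: Sind; first by apply: on_fglift zB _ => p [St _ _ _]; apply/onU.
  transitivity (to_list (ev z)); last by rewrite z0 linear0.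
  rewrite /c /bd /contr /ev /to_list !fglift_comp; apply: (eq_fglift_on zB) => p.
  by move=> [_ _ _ pE]; rewrite fglift1 -[RHS]/(to_list _) pE /bd contrU.
have <- : fglift zt c = z; last by rewrite c0 linear0.
rewrite /c fglift_comp; apply: (fglift_id_on zB) => p pT; rewrite fglift1.
have [p' -> p'T] := ztP (T p) (let: And4 St _ _ _ := pT in St).
by rewrite (Rel_inj _ _ _ p'T pT).
Qed.

(** Expand the boundary of [t] in the basis, then replace each basis element by a chosen preimage
    under [bdry], supported in the final segment of its level. *)
Lemma free_lifting (e : ord) n : free_invsys (dP e n) ->
  exists f, lifting n.+1 [set: e] f.
Proof.
move=> /free_dPP[B [Bspan Bfree]].
have /choice[z zP] t : exists z : {freeg {b : e & dP_term n b}},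
    simplex n.+1 setT t -> ev z = bdry (of_list n.+1 << t >>) /\
    forall a, (forall b, b \in t -> (a <= b)%O) ->
      on (fun p => B (tag p) (tagged p) /\ (a <= tag p)%O) z.
  have [tT|nt] := pselect (simplex n.+1 setT t); last by exists 0.
  case: t tT => [[] //|b t] tT; have minb := simplex_min tT.
  have [y yE] : exists y : dP_term n b,
      dP_val y = bdry (of_list n.+1 << b :: t >>).
    apply: bdry_dP; apply/onU; case: tT => st zt _.
    by split=> // c ct; split=> //; apply: minb.
  (* Expanding at the level of the least vertex [b] handles at once every [a] below all vertices of
     [t]. *)
  have [z zB zy] := Bspan b y; exists z => _; split; first by rewrite zy.
  move=> a /(_ b (mem_head _ _)) ab; apply: on_sub zB => p [Bp bp].
  by split=> //; apply: le_trans ab bp.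
have /choice[r rP] (p : {b : e & dP_term n b}) : exists r : chains e n.+1,
    r \in chains_in [pred b : e | (tag p <= b)%O] /\ dP_val (tagged p) = bdry r.
  by case: p => b y /=; have /asboolP[x xb yx] := valP y; exists x.
pose f t := to_list (fglift r (z t)).
have bdry_r y : bdry (fglift r y) = ev y.
  rewrite /bdry fglift_comp /ev.
  apply: (@eq_fglift_on _ _ (fun=> True)) => // p _.
  by rewrite -[LHS]/(bdry _) -(rP p).2.
exists f; split=> [t tT a ta|t tT|x xT x0].
- rewrite /f /to_list fglift_comp.
  apply: on_fglift ((zP t tT).2 a ta) _ => p [_ ap].
  apply: on_sub (chains_in_to_list (rP p).1) => u; apply: simplex_sub => b [_ pb].
  by split=> //; apply: le_trans ap pb.
- rewrite /f -to_list_bdry bdry_r (zP t tT).1 to_list_bdry of_listK //.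
  exact/onU.
(* The combined expansion evaluates to the boundary of [x], which is 0, so independence across
   levels makes it vanish. *)
have zx0 : fglift z x = 0.
  apply: Bfree.
    apply: on_fglift xT _ => t tT; case: t tT => [[] //|b t] tT.
    by apply: on_sub ((zP _ tT).2 b (simplex_min tT)) => p [].
  apply: to_list_inj; rewrite linear0 -x0 -{2}(of_listK xT) -to_list_bdry.
  congr to_list; rewrite /ev /bdry /of_list !fglift_comp.
  apply: (eq_fglift_on xT) => t tT; rewrite -[LHS]/(ev (z t)) (zP t tT).1.
  by rewrite /bdry /of_list fglift1.
have -> : fglift f x = to_list (fglift r (fglift z x)).
  by rewrite [fglift r _]fglift_comp /to_list fglift_comp.
by rewrite zx0 !linear0.
Qed.

Lemma small_acycle n (e : ord) (A : set e) :
  small n A -> exists S, acycle n.+1 A S.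
Proof.
elim: n A => [|n IH] A /=; first exact: acycle_finite.
move=> [V VP [f f_inj]]; apply: (acycleS f_inj) => b Ab; apply: IH.
apply: (small_inj (g := f)) (omega_segment (f b) VP) => [c [] //|].
by move=> c d [Ac _] [Ad _]; apply: f_inj.
Qed.

Theorem theorem3p10 (n : nat) (n_ge1 : (1 <= n)%N) (e : ord) :
  is_omega n e -> is_least_ord (fun e' : ord => ~ free_invsys (dP e' n)) e.
Proof.
move=> eP; split=> [/free_lifting[f]|e' e'nf].
  exact/no_lifting/omega_big.
(* Otherwise [e'] is isomorphic to the segment of [e] below [x], hence small, and its system would
   be free. *)
have [//|[x [g [gm gx]]]] := ord_comparable e e'.
case: e'nf; have [|S] := @small_acycle n e' setT; last exact: acycle_free.
apply: (small_inj (g := g)) (omega_segment x eP) => [w _|u v _ _].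
  by apply/gx; exists w.
exact: inc_inj.
Qed.
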